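(* Let $m$ and $n$ be positive integers, let $0\le k\le m$, and put $\kappa:=m+n$. For $r\ge1$ let $(m^r,k)$ denote the partition with $r$ parts equal to $m$ followed by one part equal to $k$ (when $k=0$ this is the partition with $r$ parts equal to $m$). Then, as formal power series in $q$ (coefficientwise limit), \[ \lim_{r\to\infty} q^{-m\binom{r}{2}-kr}\, Q_{(m^r,k)}\big(1,q,q^2,\dots;q^n\big) =\frac{(q^n;q^n)_{\infty}(q^{\kappa};q^{\kappa})_{\infty}^{n-1}}{(q;q)_{\infty}^n}\prod_{i=1}^{n-1}\theta\big(q^{i+k};q^{\kappa}\big)\prod_{1\le i<j\le n-1}\theta\big(q^{j-i};q^{\kappa}\big). \]
   Context: $(a;q)_k=\prod_{j=0}^{k-1}(1-aq^j)$, $(a;q)_\infty=\prod_{j\ge0}(1-aq^j)$, $\theta(a;q):=(a;q)_\infty(q/a;q)_\infty$. Hall–Littlewood polynomials: for variables $x=(x_1,\dots,x_N)$, a parameter $t$ and a partition $\lambda$ with at most $N$ nonzero parts, let $m_i=m_i(\lambda)$ be the number of parts equal to $i$ ($m_0:=N-$ number of nonzero parts), $v_\lambda(t)=\prod_{i\ge0}(t;t)_{m_i}/(1-t)^{m_i}$, and $P_\lambda(x;t)=\frac{1}{v_\lambda(t)}\sum_{w\in\mathfrak S_N} w\Big(x_1^{\lambda_1}\cdots x_N^{\lambda_N}\prod_{i<j}\frac{x_i-tx_j}{x_i-x_j}\Big)$ ($P_\lambda:=0$ if $\lambda$ has more than $N$ nonzero parts). Further $Q_\lambda(x;t):=b_\lambda(t)P_\lambda(x;t)$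 with $b_\lambda(t):=\prod_{i\ge1}(t;t)_{m_i(\lambda)}$. $Q_\lambda(1,q,q^2,\dots;t)$ denotes the specialization at $x_i=q^{i-1}$, $i\ge1$, of the corresponding symmetric function (the $N\to\infty$ limit of $Q_\lambda(1,q,\dots,q^{N-1};t)$). Here $t=q^n$. *)

(* Defs.v *)
From HB Require Import structures.
From mathcomp Require Import all_boot all_order all_algebra all_fingroup.
From mathcomp Require Import boolp.

Set Implicit Arguments.
Unset Strict Implicit.
Unset Printing Implicit Defensive.

Import GRing.Theory.
Local Open Scope ring_scope.

(* Formal power series over a field. The wrapper keeps the Cauchy product
   apart from the pointwise ring structure on functions. *)
Record fps (R : fieldType) := FPS { fps_coef : nat -> R }.

HB.instance Definition _ (R : fieldType) := gen_eqMixin (fps R).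
HB.instance Definition _ (R : fieldType) := gen_choiceMixin (fps R).

Lemma fpsP (R : fieldType) (p q : fps R) :
  (forall d, fps_coef p d = fps_coef q d) -> p = q.
Proof. by case: p q => [p] [q] /= /funext ->. Qed.

Section FpsRing.
Variable R : fieldType.
Implicit Types p q s : fps R.

Definition fps_zero := @FPS R (fun _ => 0).
Definition fps_one := @FPS R (fun d => (d == 0%N)%:R).
Definition fps_opp p := FPS (fun d => - fps_coef p d).
Definition fps_add p q := FPS (fun d => fps_coef p d + fps_coef q d).
Definition fps_mul p q :=
  FPS (fun d => \sum_(i < d.+1) fps_coef p i * fps_coef q (d - i)).

Fact fps_addA : associative fps_add.
Proof. by move=> p q s; apply: fpsP => d /=; rewrite addrA. Qed.
Fact fps_addC : commutative fps_add.
Proof. by move=> p q; apply: fpsP => d /=; rewrite addrC. Qed.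
Fact fps_add0 : left_id fps_zero fps_add.
Proof. by move=> p; apply: fpsP => d /=; rewrite add0r. Qed.
Fact fps_addN : left_inverse fps_zero fps_opp fps_add.
Proof. by move=> p; apply: fpsP => d /=; rewrite addNr. Qed.

HB.instance Definition _ :=
  GRing.isZmodule.Build (fps R) fps_addA fps_addC fps_add0 fps_addN.

Let mulE p q d : fps_coef (fps_mul p q) d =
  \sum_(i < d.+1) fps_coef p i * fps_coef q (d - i).
Proof. by []. Qed.

Fact fps_mulC : commutative fps_mul.
Proof.
move=> p q; apply: fpsP => d /=; rewrite (reindex_inj rev_ord_inj) /=.
by apply: eq_bigr => i _; rewrite subSS subKn 1?mulrC // -ltnS.
Qed.

Let trunc d p := \poly_(i < d.+1) fps_coef p i.

Let coef_mul_trunc d p q i : (i <= d)%N ->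
  fps_coef (fps_mul p q) i = (trunc d p * trunc d q)`_i.
Proof.
move=> le_id; rewrite coefM /=; apply: eq_bigr => j _; rewrite !coef_poly.
by rewrite !ltnS (leq_trans _ le_id) 1?(leq_trans (leq_subr _ _) le_id) // -ltnS.
Qed.

Fact fps_mulA : associative fps_mul.
Proof.
move=> p q s; apply: fpsP => d.
transitivity ((trunc d p * trunc d q * trunc d s)`_d).
  rewrite -mulrA coefM mulE; apply: eq_bigr => i _.
  rewrite -coef_mul_trunc ?leq_subr // coef_poly.
  by have -> : (i < d.+1)%N by [].
rewrite coefM mulE; apply: eq_bigr => i _.
rewrite (@coef_mul_trunc d) ?coef_poly; last by rewrite -ltnS.
by rewrite ltnS leq_subr.
Qed.

Fact fps_mul1 : left_id fps_one fps_mul.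
Proof.
move=> p; apply: fpsP => d /=; rewrite big_ord_recl /= subn0 mul1r.
by rewrite big1 ?addr0 // => i _; rewrite mul0r.
Qed.

Fact fps_mulDl : left_distributive fps_mul fps_add.
Proof.
move=> p q s; apply: fpsP => d /=; rewrite -big_split /=.
by apply: eq_bigr => i _; rewrite mulrDl.
Qed.

Fact fps_one_neq0 : fps_one != 0.
Proof.
by apply/eqP => /(congr1 (fun p => fps_coef p 0)) /eqP; rewrite /= oner_eq0.
Qed.

HB.instance Definition _ := GRing.Zmodule_isComNzRing.Build (fps R)
  fps_mulA fps_mulC fps_mul1 fps_mulDl fps_one_neq0.

Lemma fps_coef0 d : fps_coef (0 : fps R) d = 0. Proof. by []. Qed.
Lemma fps_coef1 d : fps_coef (1 : fps R) d = (d == 0%N)%:R. Proof. by []. Qed.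
Lemma fps_coefN p d : fps_coef (- p) d = - fps_coef p d. Proof. by []. Qed.
Lemma fps_coefD p q d : fps_coef (p + q) d = fps_coef p d + fps_coef q d.
Proof. by []. Qed.
Lemma fps_coefB p q d : fps_coef (p - q) d = fps_coef p d - fps_coef q d.
Proof. by []. Qed.
Lemma fps_coefM p q d :
  fps_coef (p * q) d = \sum_(i < d.+1) fps_coef p i * fps_coef q (d - i).
Proof. by []. Qed.

Lemma fps_coefX_small s j d :
  fps_coef s 0 = 0 -> (d < j)%N -> fps_coef (s ^+ j) d = 0.
Proof.
move=> s0; elim: j d => // j IHj d lt_dj; rewrite exprS fps_coefM.
rewrite big_ord_recl s0 mul0r add0r big1 // => i _; rewrite IHj ?mulr0 //.
rewrite lift0; case: d lt_dj i => [|d] lt_dj i; first by case: i.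
by rewrite subSS (leq_ltn_trans (leq_subr _ _)).
Qed.

Definition fps_unit : {pred fps R} := fun p => fps_coef p 0 != 0.

(* The inverse of c (1 - s), with s of zero constant term, is the geometric
   series c^-1 (1 + s + s^2 + ...). *)
Definition fps_inv p : fps R :=
  if fps_coef p 0 == 0 then p else
  let c := fps_coef p 0 in
  let s := 1 - FPS (fun d => c^-1 * fps_coef p d) in
  FPS (fun d => c^-1 * fps_coef (\sum_(j < d.+1) s ^+ j) d).

Lemma fps_coef_sum (I : Type) (r : seq I) (P : pred I) (F : I -> fps R) d :
  fps_coef (\sum_(i <- r | P i) F i) d = \sum_(i <- r | P i) fps_coef (F i) d.
Proof. by elim/big_rec2: _ => // i x y _ <-. Qed.

Fact fps_mulVx : {in fps_unit, left_inverse 1 fps_inv *%R}.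
Proof.
move=> p p_unit; have {p_unit}c0 : fps_coef p 0 != 0 by [].
rewrite /fps_inv (negPf c0); set c := fps_coef p 0 in c0 *.
set u := FPS (fun d => c^-1 * fps_coef p d); set s := 1 - u.
have s0 : fps_coef s 0 = 0 by rewrite fps_coefB /= mulVf // subrr.
have pE d : fps_coef p d = c * fps_coef (1 - s) d.
  by rewrite /s opprB addrC subrK /= mulrA mulfV // mul1r.
apply: fpsP => d.
transitivity (fps_coef ((\sum_(j < d.+1) s ^+ j) * (1 - s)) d).
  rewrite !fps_coefM; apply: eq_bigr => i _; rewrite pE /=.
  rewrite mulrACA mulVf // mul1r; congr (_ * _).
  rewrite !fps_coef_sum (big_ord_widen d.+1 (fun j => fps_coef (s ^+ j) i)) //.
  rewrite big_mkcond /=; apply: eq_bigr => j _.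
  by case: ltnP => // lt_ij; rewrite fps_coefX_small.
rewrite mulrC -opprB mulNr -subrX1 opprB fps_coefB.
by rewrite fps_coefX_small // subr0.
Qed.

Fact fps_unitPl p q : q * p = 1 -> fps_unit p.
Proof.
move/(congr1 (fun s => fps_coef s 0)); rewrite fps_coefM big_ord1 /= => pq1.
by apply/eqP => p0; move/eqP: pq1; rewrite p0 mulr0 eq_sym oner_eq0.
Qed.

Fact fps_inv_out : {in [predC fps_unit], fps_inv =1 id}.
Proof. by move=> p /negPn; rewrite /fps_inv => ->. Qed.

HB.instance Definition _ := GRing.ComNzRing_hasMulInverse.Build (fps R)
  fps_mulVx fps_unitPl fps_inv_out.

Lemma fps_order p : p != 0 -> exists2 i, fps_coef p i != 0 &
  forall j, (j < i)%N -> fps_coef p j = 0.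
Proof.
move=> p_neq0; have ex_p : exists i, fps_coef p i != 0.
  apply: contrapT => p0; move/eqP: p_neq0; apply; apply: fpsP => d.
  by apply/eqP; apply/negPn/negP => pd; apply: p0; exists d.
case: (ex_minnP ex_p) => i pi min_i; exists i => // j lt_ji.
by apply/eqP; apply: contraLR lt_ji => /min_i; rewrite -leqNgt.
Qed.

Fact fps_mulf_eq0 p q : p * q = 0 -> (p == 0) || (q == 0).
Proof.
move=> pq0; apply/norP => -[/fps_order[i pi lt_i] /fps_order[j qj lt_j]].
have := congr1 (fun s => fps_coef s (i + j)%N) pq0.
have lt_i_ij : (i < (i + j).+1)%N by rewrite ltnS leq_addr.
rewrite fps_coefM (bigD1 (Ordinal lt_i_ij)) //= addKn big1 ?addr0.
  by move/eqP; rewrite mulf_eq0 (negPf pi) (negPf qj).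
move=> k ne_ki; have [lt_ki|le_ik] := ltnP k i; first by rewrite lt_i ?mul0r.
have lt_ik : (i < k)%N by rewrite ltn_neqAle le_ik andbT eq_sym.
by rewrite lt_j ?mulr0 // ltn_subLR ?ltn_add2r // -ltnS.
Qed.

HB.instance Definition _ :=
  GRing.ComUnitRing_isIntegral.Build (fps R) fps_mulf_eq0.

End FpsRing.

Definition fps_X (R : fieldType) : fps R := FPS (fun d => (d == 1%N)%:R).

Notation "p %:F" := (@FracField.tofrac _ p) : ring_scope.

(* Coefficientwise limit. *)
Definition fps_cvg (R : fieldType) (u : nat -> fps R) (l : fps R) : Prop :=
  forall d, exists N0, forall N, (N0 <= N)%N ->
    fps_coef (u N) d = fps_coef l d.

Definition qpoch (R : pzRingType) (a q : R) (k : nat) : R :=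
  \prod_(j < k) (1 - a * q ^+ j).

Lemma qpochS (R : pzRingType) (a q : R) (k : nat) :
  qpoch a q k.+1 = qpoch a q k * (1 - a * q ^+ k).
Proof. by rewrite /qpoch big_ord_recr. Qed.

(* If q has zero constant term, the factors with j > d do not affect the
   coefficient of degree d; see qpoch_inf_cvg. *)
Definition qpoch_inf (R : fieldType) (a q : fps R) : fps R :=
  FPS (fun d => fps_coef (qpoch a q d.+1) d).

Lemma qpoch_inf_cvg (R : fieldType) (a q : fps R) :
  fps_coef q 0 = 0 -> fps_cvg (qpoch a q) (qpoch_inf a q).
Proof.
move=> q0 d; exists d.+1; elim=> // N IHN; rewrite leq_eqVlt => /predU1P[<-//|].
rewrite ltnS => lt_dN; rewrite -IHN // qpochS mulrBr mulr1.
rewrite fps_coefB mulrA fps_coefM [X in _ - X]big1 ?subr0 // => i _.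
by rewrite fps_coefX_small ?mulr0 // (leq_ltn_trans (leq_subr _ _)).
Qed.

(* theta(q^a; q^b) for a <= b, where q^b / q^a = q^(b - a). *)
Definition qtheta (R : fieldType) (a b : nat) : fps R :=
  let q := fps_X R in
  qpoch_inf (q ^+ a) (q ^+ b) * qpoch_inf (q ^+ (b - a)) (q ^+ b).

(* A partition is a weakly decreasing sequence of positive integers; its parts
   are nth 0 la i (counted from i = 0), extended by zeros. *)
Section HallLittlewood.
Variable F : fieldType.
Implicit Types (t : F) (la : seq nat).

(* m_i(la), relative to N variables: m_0 counts the N - size la zero parts. *)
Definition part_mult (N : nat) la (i : nat) : nat :=
  if i == 0%N then (N - size la)%N else count_mem i la.

(* Indices beyond the largest part contribute a factor 1 to v and b. *)
Definition hl_v (N : nat) t la : F :=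
  \prod_(0 <= i < (\max_(j <- la) j).+1)
    (qpoch t t (part_mult N la i) / (1 - t) ^+ part_mult N la i).

Definition hl_b t la : F :=
  \prod_(1 <= i < (\max_(j <- la) j).+1) qpoch t t (count_mem i la).

(* P_la(x; t), at points x_i of a field F with pairwise distinct x_i (so that
   the denominators x_i - x_j do not vanish); indeterminates are covered by
   taking F to be a field of rational functions. *)
Definition hlP (N : nat) (x : 'I_N -> F) t la : F :=
  if (size la <= N)%N then
    (hl_v N t la)^-1 *
    \sum_(w : 'S_N)
      ((\prod_(i < N) x (w i) ^+ nth 0%N la i) *
       \prod_(i < N) \prod_(j < N | (i < j)%N)
         ((x (w i) - t * x (w j)) / (x (w i) - x (w j))))
  else 0.

Definition hlQ (N : nat) (x : 'I_N -> F) t la : F := hl_b t la * hlP x t la.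

End HallLittlewood.

(* S = Q_la(1, q, q^2, ...; q^n): the Q_la(1, q, ..., q^(N-1); q^n), computed
   in the field of Laurent series, are power series in q, and they converge
   coefficientwise to S as N tends to infinity. *)
Definition is_hlQ_principal (R : fieldType) (la : seq nat) (n : nat)
    (S : fps R) : Prop :=
  let q := (fps_X R)%:F in
  exists u : nat -> fps R,
    (forall N, (u N)%:F = hlQ (fun i : 'I_N => q ^+ i) (q ^+ n) la) /\
    fps_cvg u S.

(* The partition (m^r, k). *)
Definition rect_part (m r k : nat) : seq nat :=
  if k == 0%N then nseq r m else rcons (nseq r m) k.

(* Main.v *)
(* At x_i = q^(i-1) and t = q^n the factor x_i - t x_j of the symmetrization
   vanishes as soon as x_i = q^n x_j, so only those orderings of the variables
   survive in which every residue class of exponents mod n is increasing.  Hence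
   Q_(m^r,k) is a sum over the sets J of the first r exponents, each J being a
   union of initial segments of the n residue classes; products along a class
   telescope.  Let s (an integer vector of sum 0) measure the deviation of J from
   {0, ..., r-1}.  The summand equals q^(m C(r,2) + k r) times a product of
   q-Pochhammer symbols, constant in the limit, times an alternating sum over S_n
   of powers of q whose exponents are quadratic in s.  The limit is therefore a
   constant times a signed sum of powers of q over the affine Weyl group of type A.

   The same computation with t = q^kappa, variables q^(c + kappa l) for
   c = 0, ..., n-2, n-1+k, and the empty partition gives the same sum over the
   affine Weyl group with w replaced by its inverse.  There P = 1, so the sum over
   J is a q-binomial coefficient; in the limit this is Macdonald's identity, which
   evaluates the sum as the product on the right-hand side. *)
Require Import Defs.
From mathcomp Require Import all_boot all_order all_algebra all_fingroup.
From mathcomp Require Import boolp ring zify.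

Set Implicit Arguments.
Unset Strict Implicit.
Unset Printing Implicit Defensive.

Import Order.TTheory GRing.Theory Num.Theory.
Local Open Scope ring_scope.

(** * Sums over permutations *)

(** The two computations match because their quadratic forms agree. For n chains of step p, the
    chain product contributes [n p] times the sum of the [tri (s i)], and the weight [x_a ^ m] adds
    [m p]. With p = n the total is [n (m + n)], which is also [n p] for p = kappa without weight;
    hence the second modulus. The starts 0, ..., n-2, n-1+k come from the variable in position r +
    1: summing its k-th power over the first free elements of the n chains turns their Vandermonde
    product into the alternant with these exponents. The obstacle is that the number of lattice
    vectors grows with r and that single terms may have negative exponents. The affine sum is
    therefore never formed: all work is modulo q^d, with the sum cut to a box of lattice vectors
    chosen independently of r. The box is stable under permuting coordinates, so the passage to
    inverses is an identity between finite sums. From the alternants on, [n.+1] is the n of the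
    theorem. *)

Lemma sum_perm_lift (V : nmodType) (N : nat) (a : 'I_N.+1) (G : 'S_N.+1 -> V) :
  \sum_(s : 'S_N.+1 | s ord0 == a) G s = \sum_(w : 'S_N) G (lift_perm ord0 a w).
Proof.
pose low (s : 'S_N.+1) := [ffun k => odflt k (unlift a (s (lift ord0 k)))].
have lowE (s : 'S_N.+1) k : s ord0 = a -> lift a (low s k) = s (lift ord0 k).
  move=> s0; rewrite ffunE; case: unliftP => [j ->//|].
  by rewrite -s0 => /perm_inj/eqP; rewrite eq_sym (negPf (neq_lift _ _)).
have low_inj (s : 'S_N.+1) : s ord0 = a -> injectiveb (low s).
  move=> s0; apply/injectiveP => k k' /(congr1 (lift a)).
  by rewrite !lowE // => /perm_inj/lift_inj.
pose drop_perm (s : 'S_N.+1) : 'S_N := insubd (1%g : 'S_N) (low s).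
have dropE (s : 'S_N.+1) k : s ord0 = a -> lift a (drop_perm s k) = s (lift ord0 k).
  by move=> s0; rewrite -lowE // -pvalE /drop_perm val_insubd low_inj.
rewrite (reindex_onto (lift_perm ord0 a) drop_perm) => [|s /eqP s0].
  apply: eq_bigl => w /=; rewrite lift_perm_id eqxx /=; apply/eqP/permP => k.
  by apply: (@lift_inj _ a); rewrite dropE ?lift_perm_id ?lift_perm_lift.
apply/permP => k; case: (unliftP ord0 k) => [k'|] ->; last by rewrite lift_perm_id.
by rewrite lift_perm_lift dropE.
Qed.

Section HallLittlewoodSums.
Variables (F : fieldType) (t : F).

Definition hl_ratio (a b : F) := (a - t * b) / (a - b).

(* Lagrange interpolation of [prod_b (X - t x_b) - prod_b (X - x_b)] at the
   points [x_a], evaluated at [X = 0]. *)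
Lemma sum_prod_hl_ratio (T : finType) (x : T -> F) (S : {set T}) :
  {in S &, injective x} -> (forall a, a \in S -> x a != 0) -> t != 1 ->
  \sum_(a in S) \prod_(b in S :\ a) hl_ratio (x a) (x b)
    = (1 - t ^+ #|S|) / (1 - t).
Proof.
move=> x_inj x_neq0 t_neq1.
pose c a := \prod_(b in S :\ a) hl_ratio (x a) (x b).
pose A := \prod_(b in S) ('X - (t * x b)%:P) - \prod_(b in S) ('X - (x b)%:P).
pose B := \sum_(a in S) ((1 - t) * x a * c a) *: \prod_(b in S :\ a) ('X - (x b)%:P).
have sub_neq0 a b : a \in S -> b \in S :\ a -> x a - x b != 0.
  move=> aS; rewrite !inE => /andP[ne_ba bS]; rewrite subr_eq0.
  by apply: contraNneq ne_ba => /x_inj ->.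
have szP (U : {set T}) (y : T -> F) :
    size (\prod_(b in U) ('X - (y b)%:P)) = #|U|.+1.
  by rewrite -big_enum size_prod_XsubC -cardE.
have monP (y : T -> F) : \prod_(b in S) ('X - (y b)%:P) \is monic.
  by apply: monic_prod => b _; rewrite monicXsubC.
(* Both sides have degree below [#|S|], the leading terms of [A] cancelling, and they agree at the
   [#|S|] distinct points [x a]. *)
have eqAB : A = B.
  apply/eqP; rewrite -subr_eq0; apply/eqP.
  apply: (@roots_geq_poly_eq0 _ _ [seq x a | a <- enum S]).
  - apply/allP => y /mapP[a]; rewrite mem_enum => aS ->.
    rewrite /root /A /B !(hornerD, hornerN) horner_sum !horner_prod.
    rewrite [X in _ - X - _](bigD1 a) //= hornerXsubC subrr mul0r subr0.
    rewrite [X in _ - X](bigD1 a) //= [X in _ - (_ + X)]big1 ?addr0; last first.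
      move=> b /andP[bS ne_ba]; rewrite hornerZ horner_prod (bigD1 a) /=.
        by rewrite hornerXsubC subrr mul0r mulr0.
      by rewrite !inE eq_sym ne_ba.
    rewrite hornerZ horner_prod (bigD1 a) //= hornerXsubC -!mulrA -big_split /=.
    rewrite mulrA subr_eq0; apply/eqP; congr (_ * _).
      by rewrite mulrBl mul1r.
    apply: eq_big => b; first by rewrite !inE andbC.
    by move=> bS; rewrite !hornerXsubC divfK // sub_neq0 // !inE andbC.
  - rewrite map_inj_in_uniq ?enum_uniq // => a b; rewrite !mem_enum.
    exact: x_inj.
  - rewrite size_map -cardE; apply: (leq_trans (size_polyD _ _)).
    rewrite size_polyN geq_max; apply/andP; split.
      apply/leq_sizeP => i; rewrite leq_eqVlt => /predU1P[<-|ltSi].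
        have lead (y : T -> F) : (\prod_(b in S) ('X - (y b)%:P))`_#|S| = 1.
          by rewrite -(monicP (monP y)) /lead_coef szP.
        by rewrite coefB (lead x) (lead (fun b => t * x b)) subrr.
      by rewrite coefB !nth_default ?subrr // szP.
    apply: (leq_trans (size_sum _ _ _)); apply/bigmax_leqP => a aS.
    by rewrite (leq_trans (size_scale_leq _ _)) // szP [#|S|](cardsD1 a) aS.
have := congr1 (fun p => p.[0]) eqAB.
rewrite /A /B hornerD hornerN horner_sum !horner_prod.
have prodE (U : {set T}) (y : T -> F) :
    \prod_(b in U) ('X - (y b)%:P).[0] = (-1) ^+ #|U| * \prod_(b in U) y b.
  rewrite -prodrN; apply: eq_bigr => b _.
  by rewrite hornerXsubC sub0r.
rewrite (prodE S x) (prodE S (fun b => t * x b)) big_split /= prodr_const.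
rewrite [RHS](eq_bigr (fun a => ((1 - t) * c a) *
   ((-1) ^+ #|S|.-1 * \prod_(b in S) x b))); last first.
  move=> a aS; rewrite hornerZ horner_prod prodE (cardsD1 a S) aS /=.
  by rewrite (big_setD1 a aS) /=; ring.
have [S0|S_neq0] := posnP #|S|.
  by move=> _; rewrite S0 expr0 subrr mul0r big1 // => a; rewrite (cards0_eq S0) inE.
rewrite -mulr_suml -mulr_sumr /c => eqS; apply: (canRL (mulfK _)).
  by rewrite subr_eq0 eq_sym.
have X_neq0 : (-1) ^+ #|S|.-1 * \prod_(b in S) x b != 0.
  rewrite mulf_neq0 ?expf_neq0 ?oppr_eq0 ?oner_eq0 //.
  by apply/prodf_neq0 => a /x_neq0.
apply: (mulIf X_neq0); rewrite mulrC [_ * (1 - t)]mulrC mulrC -eqS.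
have -> : (-1 : F) ^+ #|S| = - (-1) ^+ #|S|.-1.
  by rewrite -{1}(prednK S_neq0) exprS mulN1r.
by ring.
Qed.

Definition hl_perm_sum (N : nat) (e : nat -> nat) (x : 'I_N -> F) : F :=
  \sum_(w : 'S_N) ((\prod_(i < N) x (w i) ^+ e i) *
    \prod_(i < N) \prod_(j < N | (i < j)%N) hl_ratio (x (w i)) (x (w j))).

Lemma hl_perm_sumS (N : nat) (e : nat -> nat) (x : 'I_N.+1 -> F) :
  hl_perm_sum e x = \sum_a x a ^+ e 0%N *
    (\prod_(b | b != a) hl_ratio (x a) (x b)) *
    hl_perm_sum (fun i => e i.+1) (fun i => x (lift a i)).
Proof.
rewrite /hl_perm_sum (partition_big (fun s : 'S_N.+1 => s ord0) predT) //=.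
apply: eq_bigr => a _; rewrite big_distrr sum_perm_lift /=.
apply: eq_bigr => w _.
rewrite !big_ord_recl /= lift_perm_id mulrACA; congr (_ * _ * (_ * _)).
- rewrite big_mkcond big_ord_recl /= mul1r.
  rewrite [RHS](reindex_omap (lift a) (unlift a)) /=; last first.
    by move=> i; case: unliftP => [k ->|->]; rewrite ?eqxx.
  rewrite [RHS](eq_bigl predT) => [|i]; last by rewrite liftK eq_sym eqxx neq_lift.
  rewrite [RHS](reindex_inj (@perm_inj _ w)) /=.
  by apply: eq_bigr => i _; rewrite lift_perm_lift.
- by apply: eq_bigr => i _; rewrite lift_perm_lift.
- apply: eq_bigr => i _; rewrite big_mkcond big_ord_recl /= mul1r -big_mkcond.
  by apply: eq_bigr => j _; rewrite !lift_perm_lift.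
Qed.

Section OrderedSums.
Variables (T : finType) (x : T -> F).

(** The symmetrization as a choice of variables, one position at a time. With sets, the variables
    still free are [S :\ a] and ordinals need no reindexing; [d] may be smaller than [#|S|]. *)
Fixpoint hl_ord_sum (d : nat) (e : nat -> nat) (S : {set T}) : F :=
  if d is d'.+1 then
    \sum_(a in S) x a ^+ e 0%N * (\prod_(b in S :\ a) hl_ratio (x a) (x b)) *
      hl_ord_sum d' (fun i => e i.+1) (S :\ a)
  else 1.

Lemma hl_perm_sumE (N : nat) (e : nat -> nat) (f : 'I_N -> T) :
  injective f ->
  hl_perm_sum e (fun i => x (f i)) = hl_ord_sum N e (f @: setT).
Proof.
elim: N e f => [|N IHN] e f f_inj.
  rewrite /hl_perm_sum (eq_bigl (fun w => w == 1%g)); last first.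
    by move=> w; apply/esym/eqP/permP; case.
  by rewrite big_pred1_eq !big_ord0 mulr1.
rewrite hl_perm_sumS /= big_imset /=; last by move=> i j _ _; exact: f_inj.
apply: eq_big => [a|a _]; first by rewrite inE.
have imD1 : f @: setT :\ f a = f @: [set~ a].
  apply/setP => b; rewrite !inE; apply/andP/imsetP.
    case=> ne_ba /imsetP[c _ eq_b]; exists c => //; rewrite !inE.
    by apply: contraNneq ne_ba => <-; rewrite eq_b.
  by case=> c; rewrite !inE => ne_ca ->; rewrite inj_eq // imset_f.
congr (_ * _ * _).
  rewrite imD1 big_imset /=; last by move=> i j _ _; exact: f_inj.
  by apply: eq_bigl => b; rewrite !inE.
rewrite (IHN _ (fun i => f (lift a i))); last by move=> i j /f_inj/lift_inj.
congr hl_ord_sum; rewrite imD1; apply/setP => b; apply/imsetP/imsetP.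
  by case=> i _ ->; exists (lift a i) => //; rewrite !inE eq_sym neq_lift.
case=> c; rewrite !inE => ne_ca ->; rewrite eq_sym in ne_ca.
by have [i -> _] := unlift_some ne_ca; exists i.
Qed.

Hypotheses (x_inj : injective x) (x_neq0 : forall a, x a != 0).
Hypothesis t_neq1 : t != 1.

(** The t-factorial [r]_t!, which is also the factor of [hl_v] for a multiplicity [r]. *)
Definition hl_qfact (r : nat) : F := qpoch t t r / (1 - t) ^+ r.

Lemma hl_qfactS (r : nat) :
  hl_qfact r.+1 = hl_qfact r * ((1 - t ^+ r.+1) / (1 - t)).
Proof. by rewrite /hl_qfact qpochS -exprS (exprSr (1 - t)) invfM mulrACA. Qed.

Definition hl_cross (J S : {set T}) : F :=
  \prod_(a in J) \prod_(b in S :\: J) hl_ratio (x a) (x b).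

(** Positions with equal exponents are interchangeable: the factors inside a fixed set [J], summed
    over its orderings, give [r]_t!, and only the factors between [J] and the other variables
    remain. *)
Lemma hl_ord_sum_block (r d m : nat) (e : nat -> nat) (S : {set T}) :
  (forall i, (i < r)%N -> e i = m) ->
  hl_ord_sum (r + d) e S =
    hl_qfact r * \sum_(J : {set T} | (J \subset S) && (#|J| == r))
      (\prod_(a in J) x a ^+ m) * hl_cross J S *
      hl_ord_sum d (fun i => e (r + i)%N) (S :\: J).
Proof.
elim: r e S => [|r IHr] e S e_m.
  rewrite /hl_qfact /qpoch big_ord0 expr0 divr1 mul1r (big_pred1 set0) /=.
    by rewrite /hl_cross !big_set0 !mul1r setD0.
  by move=> J /=; rewrite cards_eq0 andbC; case: eqP => [->|//]; rewrite sub0set.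
rewrite addSn /=.
pose G a (J : {set T}) := x a ^+ m * (\prod_(b in S :\ a) hl_ratio (x a) (x b)) *
  ((\prod_(b in J) x b ^+ m) * hl_cross J (S :\ a) *
   hl_ord_sum d (fun i => e (r.+1 + i)%N) (S :\ a :\: J)).
(* The first variable joins the block, [K = a |: J]. For fixed [K], the sum over [a] in [K] is
   evaluated by [sum_prod_hl_ratio] and supplies the last factor of [r+1]_t!. *)
transitivity (hl_qfact r * \sum_(a in S)
    \sum_(K : {set T} | [&& K \subset S, #|K| == r.+1 & a \in K]) G a (K :\ a)).
  rewrite mulr_sumr; apply: eq_bigr => a aS.
  rewrite IHr; last by move=> i lt_ir; rewrite e_m.
  rewrite e_m // mulrCA; congr (_ * _); rewrite mulr_sumr.
  rewrite [RHS](reindex_onto (fun J => a |: J) (fun K => K :\ a)) /=; last first.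
    by move=> K /and3P[_ _ aK]; rewrite setD1K.
  apply: eq_big => [J|J /andP[sJ _]].
    rewrite subsetD1 !subUset sub1set aS /= cardsU1 !inE eqxx /=.
    have [aJ|aJ] := boolP (a \in J).
      rewrite !andbF /=; apply/esym/negbTE; rewrite negb_and orbC.
      by apply/orP; left; apply: contraTneq aJ => <-; rewrite !inE eqxx.
    by rewrite setU1K // eqxx add1n eqSS !andbT.
  rewrite setU1K //; apply/negP => /(subsetP sJ).
  by rewrite !inE eqxx.
rewrite (exchange_big_dep (fun K : {set T} => (K \subset S) && (#|K| == r.+1))) /=;
  last by move=> a K _ /and3P[-> ->].
rewrite hl_qfactS -mulrA; congr (_ * _); rewrite mulr_sumr.
apply: eq_bigr => K /andP[sKS /eqP cardK].
have := @sum_prod_hl_ratio _ x K; rewrite cardK => <- //; last first.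
  by move=> ? ? _ _; exact: x_inj.
rewrite mulr_suml; apply: eq_big => [a|a /and4P[aS _ _ aK]].
  have [/(subsetP sKS) ->|] := boolP (a \in K); last by rewrite !andbF.
  by rewrite sKS ?cardK !eqxx.
rewrite /G; have -> : S :\ a :\: (K :\ a) = S :\: K.
  by apply/setP => b; rewrite !inE; case: eqP => //= ->; rewrite aK.
rewrite !mulrA; congr (_ * _).
rewrite /hl_cross (big_setD1 a aK) /= [X in _ = _ * X](big_setD1 a aK) /=.
have -> : \prod_(b in S :\ a) hl_ratio (x a) (x b) =
    (\prod_(b in K :\ a) hl_ratio (x a) (x b)) *
    \prod_(b in S :\: K) hl_ratio (x a) (x b).
  rewrite (big_setID K) /=; congr (_ * _); apply: eq_bigl => b; rewrite !inE.
    case: (boolP (b \in K)) => [/(subsetP sKS) ->|]; by rewrite ?andbF ?andbT.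
  by case: eqP => //= ->; rewrite aK.
have -> : S :\ a :\: (K :\ a) = S :\: K.
  by apply/setP => b; rewrite !inE; case: eqP => //= ->; rewrite aK.
by ring.
Qed.
End OrderedSums.
End HallLittlewoodSums.

(** * Exponents in arithmetic progressions *)

Lemma card_ord_ltn (M k : nat) : (k <= M)%N -> #|[set l : 'I_M | (l < k)%N]| = k.
Proof.
move=> le_kM; rewrite -sum1_card (eq_bigl (fun l : 'I_M => (l < k)%N)).
  by rewrite -(big_ord_widen M (fun=> 1%N)) // sum_nat_const card_ord muln1.
by move=> l; rewrite inE.
Qed.

Lemma down_closed_ord (M : nat) (A : {set 'I_M}) :
  (forall l l' : 'I_M, (l < l')%N -> l' \in A -> l \in A) ->
  forall l, (l \in A) = (l < #|A|)%N.
Proof.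
move=> dcA l; apply/idP/idP => [lA|].
  rewrite -(@card_ord_ltn M l.+1) ?ltn_ord //; apply/subset_leq_card/subsetP => j.
  rewrite inE ltnS leq_eqVlt => /predU1P[/val_inj->//|lt_jl]; exact: dcA lA.
apply: contraLR => lA; rewrite -leqNgt -[X in (_ <= X)%N](@card_ord_ltn M l).
  apply/subset_leq_card/subsetP => j jA; rewrite inE ltnNge leq_eqVlt.
  apply: contra lA => /predU1P[/val_inj->//|lt_lj]; exact: dcA jA.
exact: ltnW.
Qed.

Section Chains.
Variables (F : fieldType) (q : F).
Hypotheses (q_neq0 : q != 0) (q_nroot : forall a, (0 < a)%N -> q ^+ a != 1).

Definition gap (a b : nat) : F := 1 - q ^ (b%:Z - a%:Z).

Lemma gapE (a b : nat) : gap a b = (q ^+ a - q ^+ b) / q ^+ a.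
Proof. by rewrite /gap expfzDr // -invr_expz -!exprnP mulrBl divff // expf_neq0. Qed.

Lemma expr_inj : injective (fun a : nat => q ^+ a).
Proof.
have lt_neq a b : (a < b)%N -> q ^+ a != q ^+ b.
  move=> lt_ab; rewrite -(subnKC (ltnW lt_ab)) exprD -[X in X != _]mulr1.
  by rewrite (inj_eq (mulfI (expf_neq0 _ q_neq0))) eq_sym q_nroot // subn_gt0.
move=> a b /eqP eq_ab; apply/eqP; case: ltngtP eq_ab => // /lt_neq /negPf.
  by move->.
by rewrite eq_sym => ->.
Qed.

Lemma gap_eq0 (a b : nat) : (gap a b == 0) = (a == b).
Proof.
rewrite gapE mulf_eq0 invr_eq0 (negPf (expf_neq0 _ q_neq0)) orbF subr_eq0.
by rewrite (inj_eq expr_inj).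
Qed.

Variable p : nat.
Hypothesis p_gt0 : (0 < p)%N.
Let t := q ^+ p.

(** With [t = q ^+ p], multiplication by [t] is one step along a chain. Ratios are thus quotients of
    consecutive gaps, so that they telescope along a chain and vanish when [b] is the direct
    predecessor of [a]. *)
Lemma hl_ratio_gap (a b : nat) :
  hl_ratio t (q ^+ a) (q ^+ b) = gap a (p + b) / gap a b.
Proof.
rewrite !gapE /hl_ratio /t -exprD invf_div [RHS]mulrA divfK //.
exact: expf_neq0.
Qed.

Lemma gap_telescope (a c i j : nat) : (i <= j)%N ->
  (forall l, (i <= l)%N -> a != (c + p * l)%N) ->
  \prod_(i <= l < j) hl_ratio t (q ^+ a) (q ^+ (c + p * l)) =
    gap a (c + p * j) / gap a (c + p * i).
Proof.
move=> le_ij ne_a; have [<-|ne_ij] := eqVneq i j.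
  by rewrite big_geq // divff // gap_eq0 ne_a.
under eq_bigr => l _ do rewrite hl_ratio_gap addnCA -mulnS.
rewrite (telescope_prodf (f := fun l => gap a (c + p * l))) //.
  by move=> l /andP[/ltnW le_il _]; rewrite gap_eq0 ne_a.
by rewrite ltn_neqAle ne_ij.
Qed.

Variables (n M : nat) (c : 'I_n -> nat).
Hypotheses (c_lt : forall i, (c i < p)%N) (c_inj : injective c).

Definition chain_exp (b : 'I_n * 'I_M) : nat := (c b.1 + p * b.2)%N.

Lemma chain_exp_inj : injective chain_exp.
Proof.
move=> [i l] [j l'] /= eq_e; rewrite /chain_exp /= in eq_e.
have eq_c : c i = c j.
  have := congr1 (modn^~ p) eq_e.
  by rewrite /= ![(p * _)%N]mulnC ![(c _ + _)%N]addnC !modnMDl !modn_small.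
congr (_, _); first exact: c_inj.
apply: val_inj; move/eqP: eq_e; rewrite eq_c eqn_add2l eqn_pmul2l //.
by move/eqP.
Qed.

Variable len : 'I_n -> nat.
Hypothesis len_le : forall i, (len i <= M)%N.
Definition chain_set (rho : 'I_n -> nat) : {set 'I_n * 'I_M} :=
  [set b : 'I_n * 'I_M | (b.2 < rho b.1)%N].
Let x b := q ^+ chain_exp b.
Let S := chain_set len.

Lemma big_chain_set (R : Type) (idx : R) (op : Monoid.com_law idx)
    (rho : 'I_n -> nat) (G : 'I_n * 'I_M -> R) :
  \big[op/idx]_(b in chain_set rho) G b =
  \big[op/idx]_i \big[op/idx]_(l < M | (l < rho i)%N) G (i, l).
Proof.
rewrite pair_big_dep /=; apply: eq_big => [[i l]|[i l] _] //=.
by rewrite inE.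
Qed.

Lemma card_chain_set (rho : 'I_n -> nat) : (forall i, (rho i <= M)%N) ->
  #|chain_set rho| = (\sum_i rho i)%N.
Proof.
move=> rho_le; rewrite -sum1_card big_chain_set /=; apply: eq_bigr => i _.
rewrite -[RHS](@card_ord_ltn M) // -sum1_card; apply: eq_bigl => l.
by rewrite inE.
Qed.

Lemma hl_ratio_eq0 (a b : nat) : a = (p + b)%N -> hl_ratio t (q ^+ a) (q ^+ b) = 0.
Proof. by move=> ->; rewrite hl_ratio_gap (eqP (_ : gap _ _ == 0)) ?mul0r ?gap_eq0. Qed.

(** If [J] skips an element of a chain, some element of [J] has its direct predecessor outside [J],
    and the ratio of this pair is zero. *)
Lemma hl_cross_chain_eq0 (J : {set 'I_n * 'I_M}) (i : 'I_n) (l l' : 'I_M) :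
  J \subset S -> (l < l')%N -> (i, l') \in J -> (i, l) \notin J ->
  hl_cross t x J S = 0.
Proof.
move=> sJS lt_ll' l'J lJ.
(* The least such [k] is wanted: its predecessor is outside [J], by minimality or because it is [l]
   itself. *)
have ex_k : exists k, (l < k)%N && [exists k' : 'I_M, (k' == k :> nat) && ((i, k') \in J)].
  by exists l'; rewrite lt_ll'; apply/existsP; exists l'; rewrite eqxx.
case: (ex_minnP ex_k) => k /andP[lt_lk /existsP[k' /andP[/eqP eq_k k'J]]] min_k.
have lt_kM : (k.-1 < M)%N by rewrite -eq_k (leq_ltn_trans (leq_pred _)).
pose b := Ordinal lt_kM; have k_gt0 : (0 < k)%N := leq_ltn_trans (leq0n _) lt_lk.
have bJ : (i, b) \notin J.
  have [->|ne_bl] := eqVneq b l; first by [].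
  apply/negP => bJ; have : (k <= k.-1)%N; last by lia.
  apply: min_k; apply/andP; split.
    by move: ne_bl; rewrite -val_eqE /=; lia.
  by apply/existsP; exists b; rewrite eqxx.
have bS : (i, b) \in S :\: J.
  have := subsetP sJS _ k'J; rewrite !inE bJ /= eq_k; lia.
rewrite /hl_cross (bigD1 (i, k')) //= (bigD1 (i, b)) //= hl_ratio_eq0 ?mul0r //.
by rewrite /chain_exp /= eq_k addnCA -mulnS prednK.
Qed.

Definition chain_count (r : nat) (J : {set 'I_n * 'I_M}) : {ffun 'I_n -> 'I_r.+1} :=
  [ffun i => inord #|[set l : 'I_M | (i, l) \in J]|].

(** A surviving set is an initial segment of each chain, hence given by lengths [rho]. The
    assumption [r <= len i] makes every [rho] with values at most [r] fit into [S]. *)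
Lemma sum_hl_cross_chain (r : nat) (G : {set 'I_n * 'I_M} -> F) :
  (forall i, (r <= len i)%N) ->
  \sum_(J : {set 'I_n * 'I_M} | (J \subset S) && (#|J| == r))
     hl_cross t x J S * G J =
  \sum_(rho : {ffun 'I_n -> 'I_r.+1} | (\sum_i rho i == r)%N)
     hl_cross t x (chain_set (fun i => rho i)) S * G (chain_set (fun i => rho i)).
Proof.
move=> le_r.
pose closed (J : {set 'I_n * 'I_M}) :=
  [forall i, forall l : 'I_M, forall l' : 'I_M,
    (l < l')%N && ((i, l') \in J) ==> ((i, l) \in J)].
rewrite (bigID closed) /= [X in _ + X]big1 ?addr0; last first.
  move=> J /andP[/andP[sJS _]] /forallPn[i /forallPn[l /forallPn[l']]].
  rewrite negb_imply => /andP[/andP[lt_ll' l'J] lJ].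
  by rewrite (hl_cross_chain_eq0 sJS lt_ll' l'J lJ) mul0r.
have row_le (J : {set 'I_n * 'I_M}) i : (#|[set l : 'I_M | (i, l) \in J]| <= #|J|)%N.
  rewrite -(card_imset _ (_ : injective (pair i))); last by move=> l l' [].
  by apply/subset_leq_card/subsetP => b /imsetP[l]; rewrite inE => lJ ->.
have rowE (rho : {ffun 'I_n -> 'I_r.+1}) i :
    #|[set l : 'I_M | (i, l) \in chain_set (fun i => rho i)]| = rho i.
  rewrite -[RHS](@card_ord_ltn M); last first.
    by rewrite (leq_trans _ (len_le i)) // (leq_trans _ (le_r i)) // -ltnS.
  by apply: eq_card => l; rewrite !inE.
rewrite (reindex_onto (fun rho : {ffun 'I_n -> 'I_r.+1} => chain_set (fun i => rho i))
  (chain_count r)) /=; last first.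
  move=> J /andP[/andP[sJS /eqP cardJ] /forallP clJ]; apply/setP => -[i l].
  rewrite inE /= ffunE inordK; last by rewrite ltnS -cardJ row_le.
  rewrite -down_closed_ord ?inE // => l1 l2 lt12; rewrite !inE => l2J.
  by have /forallP/(_ l1)/forallP/(_ l2) := clJ i; rewrite lt12 l2J.
apply: eq_bigl => rho.
have rho_le i : (rho i <= len i)%N by rewrite (leq_trans _ (le_r i)) // -ltnS.
rewrite card_chain_set; last by move=> i; rewrite (leq_trans (rho_le i)).
have -> : chain_set (fun i => rho i) \subset S.
  by apply/subsetP => -[i l]; rewrite !inE /= => /leq_trans; apply.
have -> : closed (chain_set (fun i => rho i)).
  apply/forallP => i; apply/forallP => l; apply/forallP => l'; apply/implyP.
  by rewrite !inE /= => /andP[/ltn_trans]; apply.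
rewrite andbT /=; apply/andb_idr => _; apply/eqP/ffunP => i; apply: val_inj.
by rewrite ffunE /= rowE inordK.
Qed.

(* [1 - x_b / x_a], multiplied over [a] in [chain_set rho] and [b] = element number
   [y j] of each chain [j]. *)
Definition chain_prod (rho y : 'I_n -> nat) : F :=
  \prod_i \prod_(l < rho i) \prod_j gap (c i + p * l) (c j + p * y j).

Lemma chain_end_neq (rho : 'I_n -> nat) (i j : 'I_n) (l l' : nat) :
  (l < rho i)%N -> (rho j <= l')%N -> (c i + p * l)%N != (c j + p * l')%N.
Proof.
move=> lt_l le_l'; apply/eqP => eq_e.
have eq_ij : i = j.
  apply: c_inj; have := congr1 (modn^~ p) eq_e.
  by rewrite /= ![(p * _)%N]mulnC ![(c _ + _)%N]addnC !modnMDl !modn_small.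
move/eqP: eq_e; rewrite eq_ij eqn_add2l eqn_pmul2l // => /eqP eq_l.
by move: lt_l; rewrite eq_ij eq_l ltnNge le_l'.
Qed.

Lemma prod_chain_setD (rho : 'I_n -> nat) (a : nat) :
  (forall i, (rho i <= len i)%N) ->
  (forall j l, (rho j <= l)%N -> a != (c j + p * l)%N) ->
  \prod_(b in S :\: chain_set rho) hl_ratio t (q ^+ a) (x b) =
    \prod_j (gap a (c j + p * len j) / gap a (c j + p * rho j)).
Proof.
move=> rho_le ne_a.
transitivity (\prod_j \prod_(l < M | (rho j <= l < len j)%N)
    hl_ratio t (q ^+ a) (q ^+ (c j + p * l))).
  rewrite pair_big_dep /=; apply: eq_big => [[i l]|[i l] _] //=.
  by rewrite !inE /= -leqNgt.
apply: eq_bigr => j _; rewrite -gap_telescope //; last by move=> l; exact: ne_a.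
rewrite [RHS](big_nat_widen _ _ M) // [RHS](big_nat_widenl _ 0) // big_mkord.
by apply: eq_bigl => l; rewrite andbC.
Qed.

Lemma hl_cross_chain (rho : 'I_n -> nat) : (forall i, (rho i <= len i)%N) ->
  hl_cross t x (chain_set rho) S = chain_prod rho len / chain_prod rho rho.
Proof.
move=> rho_le; rewrite /hl_cross big_chain_set /= /chain_prod -prodf_div.
apply: eq_bigr => i _; rewrite -prodf_div.
rewrite [RHS](big_ord_widen M (fun l => (\prod_j gap (c i + p * l) (c j + p * len j)) /
  \prod_j gap (c i + p * l) (c j + p * rho j))); last exact: leq_trans (len_le i).
apply: eq_bigr => l lt_l; rewrite /x /chain_exp /= prod_chain_setD //.
  by rewrite prodf_div.
by move=> j l' le_l'; exact: chain_end_neq le_l'.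
Qed.

(** Only the first free element of a chain can come next: for a later one, its predecessor is still
    free and gives the factor zero. The factor [1 - t] cancels the gap from the chosen element to
    its successor on the same chain. *)
Lemma sum_chain_next (rho : 'I_n -> nat) (k : nat) :
  (forall i, (rho i < len i)%N) ->
  (1 - t) * (\sum_(a in S :\: chain_set rho) x a ^+ k *
     \prod_(b in S :\: chain_set rho :\ a) hl_ratio t (x a) (x b)) =
  \sum_i (q ^+ (c i + p * rho i)) ^+ k *
    (\prod_j gap (c i + p * rho i) (c j + p * len j) /
     \prod_(j | j != i) gap (c i + p * rho i) (c j + p * rho j)).
Proof.
move=> rho_lt.
pose f b := x b ^+ k * \prod_(b' in S :\: chain_set rho :\ b) hl_ratio t (x b) (x b').
transitivity ((1 - t) * (\sum_i \sum_(l < M | (rho i <= l < len i)%N) f (i, l))).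
  congr (_ * _); rewrite pair_big_dep /=; apply: eq_big => [[i l]|[i l] _] //=.
  by rewrite !inE /= -leqNgt.
rewrite mulr_sumr; apply: eq_bigr => i _.
have lt_rM : (rho i < M)%N := leq_trans (rho_lt i) (len_le i).
pose l0 := Ordinal lt_rM.
rewrite (bigD1 l0) /=; last by rewrite leqnn rho_lt.
rewrite big1 ?addr0; last first.
  move=> l /andP[/andP[le_l lt_l] ne_l].
  have lt_rl : (rho i < l)%N.
    by rewrite ltn_neqAle le_l andbT eq_sym; move: ne_l; rewrite -val_eqE.
  have lt_l'M : (l.-1 < M)%N by rewrite (leq_ltn_trans (leq_pred _)).
  rewrite /f (bigD1 (i, Ordinal lt_l'M)) /=.
    rewrite hl_ratio_eq0 ?mul0r ?mulr0 // /chain_exp /= addnCA -mulnS prednK //.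
    exact: leq_ltn_trans lt_rl.
  by rewrite !inE /= xpair_eqE eqxx /= -val_eqE /=; lia.
(* Chain lengths once the next element of chain [i] has been taken as well. *)
pose rho' j := (rho j + (j == i))%N.
have D1E : S :\: chain_set rho :\ (i, l0) = S :\: chain_set rho'.
  apply/setP => -[j l]; rewrite !inE /= xpair_eqE /rho' -[l == l0]/(l == rho i :> nat).
  by have [->|/negPf ne_ji] := eqVneq j i; rewrite ?eqxx ?ne_ji ?addn1 ?addn0 /=; lia.
have le_rho' j : (rho' j <= len j)%N.
  by rewrite /rho'; have := rho_lt j; case: (j == i); lia.
have lt_rho' : (rho i < rho' i)%N by rewrite /rho' eqxx addn1.
rewrite /f D1E /x {1 2}/chain_exp /= prod_chain_setD //; last first.
  by move=> j l le_l; exact: chain_end_neq le_l.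
rewrite mulrCA prodf_div; congr (_ * _).
have -> : \prod_j gap (c i + p * rho i) (c j + p * rho' j) =
    (1 - t) * \prod_(j | j != i) gap (c i + p * rho i) (c j + p * rho j).
  rewrite (bigD1 i) //= /rho' eqxx addn1; congr (_ * _).
    by rewrite /gap mulnS addnCA PoszD addrK.
  by apply: eq_bigr => j /negPf->; rewrite addn0.
rewrite invfM mulrCA [(1 - t) * _]mulrA divff ?mul1r //.
by rewrite subr_eq0 eq_sym q_nroot.
Qed.

End Chains.

(** * Normalization of Q for the partition (m^r, k) *)

Section Normalization.
Variables (F : fieldType) (t : F).
Hypothesis t_nroot : forall a, (0 < a)%N -> t ^+ a != 1.

Lemma qpoch_tt_neq0 (k : nat) : qpoch t t k != 0.
Proof.
apply/prodf_neq0 => j _; rewrite -exprS subr_eq0 eq_sym; exact: t_nroot.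
Qed.

Lemma hl_qfact_neq0 (k : nat) : hl_qfact t k != 0.
Proof.
rewrite mulf_neq0 ?qpoch_tt_neq0 // invr_eq0 expf_neq0 // subr_eq0 eq_sym.
exact: (t_nroot (ltn0Sn 0)).
Qed.

Lemma sum_count_mem (la : seq nat) (b : nat) :
  all (fun x => 0 < x < b)%N la ->
  (\sum_(1 <= i < b) count_mem i la = size la)%N.
Proof.
elim: la => [_|x la IHla /= /andP[x_b la_b]]; first by rewrite big1.
rewrite big_split /= IHla // -[RHS]add1n; congr (_ + _)%N.
under eq_bigr => i _ do rewrite eq_sym.
rewrite (eq_bigr (fun i => if i == x then 1%N else 0%N)); last by move=> i _; case: eqP.
by rewrite -big_mkcond big_nat1_eq x_b.
Qed.

(** For each [i > 0] the factors of [hl_b] and [hl_v] differ by [1 - t] to the multiplicity of [i];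
    the factor of [hl_v] for the zero parts is left over. *)
Lemma hl_b_div_v (N : nat) (la : seq nat) :
  all (fun i => 0 < i)%N la ->
  hl_b t la / hl_v N t la = (1 - t) ^+ size la / hl_qfact t (N - size la).
Proof.
move=> la_gt0; rewrite /hl_b /hl_v [X in _ / X]big_ltn //.
set b := (\max_(j <- la) j).+1.
have sub1_neq0 : 1 - t != 0 by rewrite subr_eq0 eq_sym (t_nroot (ltn0Sn 0)).
set V := \prod_(1 <= i < b) (_ / _).
have V_neq0 : V != 0.
  by rewrite prodf_seq_neq0; apply/allP => i _; apply/implyP => _; exact: hl_qfact_neq0.
have -> : \prod_(1 <= i < b) qpoch t t (count_mem i la) = (1 - t) ^+ size la * V.
  rewrite -(@sum_count_mem la b); last first.
    apply/allP => i i_la; rewrite (allP la_gt0) //= ltnS.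
    by rewrite (big_rem i) //= leq_maxl.
  rewrite -prodrXr -big_split /=; apply: eq_big_nat => i /andP[i_gt0 _].
  by rewrite /part_mult (gtn_eqF i_gt0) mulrC divfK // expf_neq0.
by rewrite -/(hl_qfact t (N - size la)) invfM mulrA [_ / _ / _]mulrAC mulfK.
Qed.

Lemma hlQ_perm_sum (N : nat) (x : 'I_N -> F) (la : seq nat) :
  all (fun i => 0 < i)%N la -> (size la <= N)%N ->
  hlQ x t la = (1 - t) ^+ size la / hl_qfact t (N - size la) *
    hl_perm_sum t (nth 0%N la) x.
Proof.
move=> la_gt0 le_laN; rewrite /hlQ /hlP le_laN mulrA hl_b_div_v //.
Qed.

Lemma nth_rect_part (m r k i : nat) :
  nth 0%N (rect_part m r k) i = if (i < r)%N then m else if i == r then k else 0%N.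
Proof.
rewrite /rect_part; case: eqP => [->|_]; rewrite ?nth_rcons nth_nseq ?size_nseq.
  by case: ifP => // _; case: ifP.
by case: (i < r)%N.
Qed.

Lemma size_rect_part (m r k : nat) : size (rect_part m r k) = (r + (0 < k))%N.
Proof.
by rewrite /rect_part; case: k => [|k] /=; rewrite ?size_rcons size_nseq ?addn0 ?addn1.
Qed.

Lemma rect_part_gt0 (m r k : nat) : (0 < m)%N ->
  all (fun i => 0 < i)%N (rect_part m r k).
Proof.
move=> m_gt0; rewrite /rect_part; case: k => [|k] /=.
  by rewrite all_nseq m_gt0 orbT.
by rewrite all_rcons all_nseq m_gt0 orbT.
Qed.

Section RectangularHL.
Variables (T : finType) (x : T -> F).
Hypotheses (x_inj : injective x) (x_neq0 : forall a, x a != 0).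

(** One block containing all variables, with exponent zero; this is why P = 1 for the empty
    partition. *)
Lemma hl_ord_sum_full (e : nat -> nat) (S : {set T}) :
  (forall i, (i < #|S|)%N -> e i = 0%N) -> hl_ord_sum t x #|S| e S = hl_qfact t #|S|.
Proof.
move=> e0; rewrite -[X in hl_ord_sum _ _ X]addn0.
rewrite (hl_ord_sum_block x_inj x_neq0 (t_nroot (ltn0Sn 0)) 0 _ e0).
rewrite (big_pred1 S) /=; last first.
  move=> J; apply/andP/eqP => [[sJS /eqP cardJ]|->]; last by rewrite subxx.
  by apply/eqP; rewrite eqEcard sJS cardJ leqnn.
rewrite /hl_cross setDv mulr1 [X in _ * (X * _)]big1 ?mul1r; last first.
  by move=> a _; rewrite expr0.
by rewrite big1 ?mulr1 // => a _; rewrite big_set0.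
Qed.

(** For exponents zero, cutting the positions after the first [r] writes [#|S|]_t! as [r]_t! times
    this sum times [#|S| - r]_t!; the sum is a t-binomial coefficient. *)
Lemma sum_hl_cross (r : nat) (S : {set T}) : (r <= #|S|)%N ->
  \sum_(J : {set T} | (J \subset S) && (#|J| == r)) hl_cross t x J S =
    qpoch t t #|S| / (qpoch t t r * qpoch t t (#|S| - r)).
Proof.
move=> le_rS; pose s := (#|S| - r)%N; have S_rs : #|S| = (r + s)%N by rewrite subnKC.
have := @hl_ord_sum_full (fun=> 0%N) S (fun _ _ => erefl).
rewrite {1}S_rs (@hl_ord_sum_block _ _ _ _ x_inj x_neq0 (t_nroot (ltn0Sn 0)) r s 0%N) //.
rewrite (eq_bigr (fun J => hl_cross t x J S * hl_qfact t s)); last first.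
  move=> J /andP[sJS /eqP cardJ].
  rewrite big1 ?mul1r => [|a _]; last by rewrite expr0.
  have cardD : #|S :\: J| = s by rewrite cardsD (setIidPr sJS) cardJ.
  by rewrite -cardD hl_ord_sum_full.
rewrite -mulr_suml => eqS; rewrite -/s.
apply: (mulfI (hl_qfact_neq0 r)); apply: (mulIf (hl_qfact_neq0 s)).
rewrite -mulrA eqS /hl_qfact S_rs exprD.
have pr := qpoch_tt_neq0 r; have ps := qpoch_tt_neq0 s.
have t1 : 1 - t != 0 by rewrite subr_eq0 eq_sym (t_nroot (ltn0Sn 0)).
by field; rewrite pr ps !expf_neq0.
Qed.

(** A block of [r] positions, one position for the part [k], then a block with exponent zero. For
    [k = 0] the middle position is split off from the [N - r] zero parts counted together in [hl_v];
    the factor [(1 - t ^+ (N - r))^-1] corrects for this and disappears in the limit of large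
    [N]. *)
Lemma hlQ_rect (m r k N : nat) (f : 'I_N -> T) : (0 < m)%N -> (r < N)%N -> injective f ->
  let S := f @: setT in
  hlQ (fun i => x (f i)) t (rect_part m r k) =
    qpoch t t r * (if k == 0%N then (1 - t ^+ (N - r))^-1 else 1) *
    \sum_(J : {set T} | (J \subset S) && (#|J| == r)) hl_cross t x J S *
      ((\prod_(a in J) x a ^+ m) *
       ((1 - t) * \sum_(a in S :\: J) x a ^+ k *
         \prod_(b in S :\: J :\ a) hl_ratio t (x a) (x b))).
Proof.
move=> m_gt0 lt_rN f_inj S.
have cardS : #|S| = N by rewrite card_imset // cardsT card_ord.
have t1 : 1 - t != 0 by rewrite subr_eq0 eq_sym (t_nroot (ltn0Sn 0)).
rewrite hlQ_perm_sum ?rect_part_gt0 ?size_rect_part //; last first.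
  by case: (0 < k)%N; lia.
rewrite (hl_perm_sumE _ x) // -/S.
pose s := (N - r).-1; have Nrs : N = (r + s.+1)%N by rewrite /s; lia.
rewrite [X in hl_ord_sum _ _ X]Nrs (hl_ord_sum_block x_inj x_neq0 (t_nroot (ltn0Sn 0)) s.+1 (m := m));
  last by move=> i lt_ir; rewrite nth_rect_part lt_ir.
rewrite (eq_bigr (fun J : {set T} => hl_qfact t s / (1 - t) *
   (hl_cross t x J S * ((\prod_(a in J) x a ^+ m) *
       ((1 - t) * \sum_(a in S :\: J) x a ^+ k *
         \prod_(b in S :\: J :\ a) hl_ratio t (x a) (x b)))))); last first.
  move=> J /andP[sJS /eqP cardJ] /=.
  have -> : \sum_(a in S :\: J) x a ^+ nth 0%N (rect_part m r k) (r + 0) *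
      (\prod_(b in S :\: J :\ a) hl_ratio t (x a) (x b)) *
      hl_ord_sum t x s (fun i => nth 0%N (rect_part m r k) (r + i.+1)) (S :\: J :\ a) =
      (\sum_(a in S :\: J) x a ^+ k *
         \prod_(b in S :\: J :\ a) hl_ratio t (x a) (x b)) * hl_qfact t s.
    rewrite mulr_suml; apply: eq_bigr => a aSJ.
    rewrite nth_rect_part addn0 ltnn eqxx; congr (_ * _).
    have cardD : #|S :\: J :\ a| = s.
      have := cardsD1 a (S :\: J); rewrite aSJ cardsD (setIidPr sJS) cardJ cardS.
      by rewrite /s; lia.
    rewrite -cardD hl_ord_sum_full // => i _; rewrite nth_rect_part.
    by rewrite ltnNge leq_addr /= -{2}[r]addn0 eqn_add2l.
  by field.
rewrite -mulr_sumr; set Z := \sum_(J | _) _.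
rewrite -[N]/N Nrs !mulrA; congr (_ * _); rewrite addKn /hl_qfact.
have pr := qpoch_tt_neq0 r; have ps := qpoch_tt_neq0 s.
case: k {Z} => [|k] /=.
  rewrite !addn0 addKn qpochS (exprS t s) (exprS (1 - t) s).
  have tS : 1 - t * t ^+ s != 0 by rewrite -exprS subr_eq0 eq_sym t_nroot.
  by field; rewrite t1 ps tS !expf_neq0.
rewrite subnDA addKn addn1 subn1 /= (exprS (1 - t) r).
by field; rewrite ps t1 !expf_neq0.
Qed.
End RectangularHL.
End Normalization.

(** * Chain products as q-Pochhammer symbols *)

Lemma big_pair_split (R : Type) (idx : R) (op : Monoid.com_law idx) (n : nat)
    (G : 'I_n -> 'I_n -> R) :
  \big[op/idx]_i \big[op/idx]_j G i j =
  op (\big[op/idx]_i G i i)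
     (\big[op/idx]_(i < n) \big[op/idx]_(j < n | (i < j)%N) op (G i j) (G j i)).
Proof.
under [X in op _ X]eq_bigr => i _ do rewrite big_split.
rewrite big_split /= [X in op _ (op _ X)](exchange_big_dep predT) //= -!big_split /=.
apply: eq_bigr => i _; rewrite (bigD1 i) //=; congr (op _ _).
rewrite (bigID (fun j : 'I_n => (i < j)%N)) /=; congr (op _ _).
  by apply: eq_bigl => j; case: (ltnP i j) => [lt_ij|]; rewrite ?andbF // -val_eqE /= gtn_eqF.
by apply: eq_bigl => j; rewrite -val_eqE /= -leqNgt andbC ltn_neqAle andbC.
Qed.

Lemma card_ord_gtn (n : nat) (i : 'I_n) : #|[pred j : 'I_n | (i < j)%N]| = (n - i.+1)%N.
Proof.
have := cardC [pred j : 'I_n | (j < i.+1)%N]; rewrite card_ord.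
have -> : #|[pred j : 'I_n | (j < i.+1)%N]| = i.+1.
  by rewrite -[RHS](@card_ord_ltn n i.+1) //; apply: eq_card => j; rewrite !inE.
have -> : #|[predC [pred j : 'I_n | (j < i.+1)%N]]| = #|[pred j : 'I_n | (i < j)%N]|.
  by apply: eq_card => j; rewrite !inE -leqNgt.
by lia.
Qed.

(** The binomial coefficient C(z, 2), extended to negative [z]. *)
Definition tri (z : int) : int := ((z * (z - 1)) %/ 2)%Z.

Lemma triE (z : int) : 2 * tri z = z * (z - 1).
Proof.
rewrite /tri mulrC divzK //; have [a [b [-> b01]]] : exists a b : int, z = 2 * a + b /\ b * (b - 1) = 0.
  exists (z %/ 2)%Z, (z %% 2)%Z; split; first by rewrite mulrC -divz_eq.
  have := ltz_pmod z (erefl : 0 < 2 :> int); have := modz_ge0 z (erefl : 2 != 0 :> int).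
  nia.
apply/dvdzP; exists (a * (2 * a + 2 * b - 1)).
by transitivity ((a * (2 * a + 2 * b - 1)) * 2 + b * (b - 1)); [ring | rewrite b01 addr0].
Qed.

Lemma mulr2I_int (a b : int) : 2 * a = 2 * b -> a = b.
Proof. lia. Qed.

Lemma triD (a b : int) : tri (a + b) = tri a + tri b + a * b.
Proof. by apply: mulr2I_int; rewrite !mulrDr !triE; ring. Qed.

Lemma triS (l : nat) : tri l.+1 = tri l + l%:Z.
Proof. by rewrite -addn1 PoszD triD (_ : tri 1 = 0) // addr0 mulr1. Qed.

Lemma prod_expz (F : fieldType) (q : F) (I : Type) (r : seq I) (P : pred I)
    (f : I -> int) : q != 0 ->
  \prod_(i <- r | P i) q ^ f i = q ^ (\sum_(i <- r | P i) f i).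
Proof.
move=> q0; apply: (big_ind2 (fun x y => x = q ^ y)) => [|x1 x2 y1 y2 -> ->|//].
  by rewrite expr0z.
by rewrite expfzDr.
Qed.

Section PairSums.
Variable n : nat.
Implicit Types s g : 'I_n -> int.

Lemma sum_const_int (a : int) : \sum_(i < n) a = n%:Z * a.
Proof. by rewrite sumr_const card_ord -mulr_natl natz. Qed.

Lemma sum_ltn_sub s : \sum_i s i = 0 ->
  \sum_(i < n) \sum_(j < n | (i < j)%N) (s j - s i) = 2 * \sum_(i < n) (i%:Z * s i).
Proof.
move=> s0; under eq_bigr => i _ do rewrite sumrB.
rewrite sumrB (exchange_big_dep predT) //= -sumrB mulr_sumr.
transitivity (\sum_(i < n) (2 * (i%:Z * s i) - (n%:Z - 1) * s i)); last first.
  by rewrite sumrB -[X in _ - X]mulr_sumr s0 mulr0 subr0.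
apply: eq_bigr => i _; rewrite !sumr_const.
have card_lt : #|[pred j : 'I_n | (j < i)%N]| = i.
  rewrite -[RHS](@card_ord_ltn n i) 1?ltnW //; by apply: eq_card => j; rewrite !inE.
rewrite card_lt card_ord_gtn -(mulr_natr _ i) -(mulr_natr _ (n - i.+1)).
have -> : (n - i.+1)%N%:R = n%:Z - i%:Z - 1 :> int.
  by rewrite natz; have := ltn_ord i; lia.
by rewrite natz; ring.
Qed.

(** Four times the summand is symmetric in [i] and [j] up to a multiple of [s j - s i]. The
    symmetric part becomes an unrestricted double sum, where the zero sum of [s] removes the mixed
    terms; the rest is [sum_ltn_sub]. *)
Lemma sum_ltn_tri s g (p : int) : \sum_i s i = 0 ->
  \sum_(i < n) \sum_(j < n | (i < j)%N)
     ((s j - s i) * (g j - g i) + p * tri (s j - s i)) =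
  n%:Z * \sum_i (g i * s i) + n%:Z * p * \sum_i tri (s i) - p * \sum_(i < n) (i%:Z * s i).
Proof.
move=> s0; apply: mulr2I_int; apply: mulr2I_int.
have sum0 z : \sum_i s i * z = 0 by rewrite -mulr_suml s0 mul0r.
pose S i j := 2 * (s j - s i) * (g j - g i) + p * (s j - s i) ^+ 2.
have -> : 2 * (2 * \sum_(i < n) \sum_(j < n | (i < j)%N)
     ((s j - s i) * (g j - g i) + p * tri (s j - s i))) =
  \sum_(i < n) \sum_(j < n | (i < j)%N) (S i j + S j i)
  - 2 * p * (\sum_(i < n) \sum_(j < n | (i < j)%N) (s j - s i)).
  rewrite !mulr_sumr -sumrB; apply: eq_bigr => i _; rewrite !mulr_sumr -sumrB.
  apply: eq_bigr => j _; rewrite !mulrDr.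
  have -> : 2 * (2 * (p * tri (s j - s i))) = 2 * p * (2 * tri (s j - s i)) by ring.
  by rewrite triE /S; ring.
have -> : \sum_(i < n) \sum_(j < n | (i < j)%N) (S i j + S j i) = \sum_i \sum_j S i j.
  rewrite big_pair_split /= [X in X + _]big1 ?add0r // => i _.
  by rewrite /S; ring.
rewrite sum_ltn_sub //.
have -> : \sum_i \sum_j S i j = 4 * n%:Z * \sum_i (g i * s i) + 2 * n%:Z * p * \sum_i (s i ^+ 2).
  transitivity (\sum_i (2 * n%:Z * (g i * s i) + n%:Z * p * s i ^+ 2 +
     (2 * \sum_j (g j * s j) + p * \sum_j s j ^+ 2)
       - s i * (2 * \sum_j g j))).
    apply: eq_bigr => i _.
    transitivity (\sum_j (2 * (g i * s i) + p * s i ^+ 2 + 2 * (g j * s j) + p * s j ^+ 2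
       - s i * (2 * g j) - s j * (2 * g i + 2 * p * s i))).
      by apply: eq_bigr => j _; rewrite /S; ring.
    rewrite !(sumrB, big_split) /= sum0 subr0 -!mulr_sumr !sum_const_int; ring.
  rewrite !(sumrB, big_split) /= sum0 subr0 -!mulr_sumr !sum_const_int; ring.
have -> : \sum_i s i ^+ 2 = 2 * \sum_i tri (s i).
  rewrite mulr_sumr; transitivity (\sum_i (s i ^+ 2 - s i)).
    by rewrite sumrB s0 subr0.
  apply: eq_bigr => i _.
  by rewrite triE; ring.
ring.
Qed.
End PairSums.

Section ChainProduct.
Variables (F : fieldType) (q : F).
Hypotheses (q_neq0 : q != 0).
Variable p : nat.

Lemma prod_signed_expz (d : int) (b B : nat) :
  \prod_(l < B) (- q ^ (d + p%:Z * (l%:Z - b%:Z))) =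
  (-1) ^+ B * q ^ (B%:Z * d + p%:Z * (tri B%:Z - b%:Z * B%:Z)).
Proof.
elim: B => [|B IHB].
  by rewrite big_ord0 mul1r (_ : _ + _ = 0) ?expr0z // /tri !mul0r mulr0 subr0 div0z mulr0.
rewrite big_ord_recr /= IHB exprS -(mulN1r (q ^ _)) mulrACA -expfzDr //.
rewrite [(-1) ^+ B * _]mulrC; congr (_ * q ^ _).
by rewrite triS -addn1 PoszD; ring.
Qed.

Lemma qpoch_expz (a k : nat) :
  qpoch (q ^+ a) (q ^+ p) k = \prod_(l < k) (1 - q ^ (a%:Z + p%:Z * l%:Z)).
Proof.
by apply: eq_bigr => l _; rewrite -exprM -exprD exprnP PoszD PoszM.
Qed.

Definition chain_factor (d : int) (A : nat) : F :=
  \prod_(l < A) (1 - q ^ (d + p%:Z * l.+1%:Z)).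

(* The factors of both sides are [1 - w l] with [w l = q ^ (delta + p (l - b))], up to
   [1 - 1 / w l = - (1 - w l) / w l]. *)
Lemma chain_factor_pair (delta : nat) (e : int) (A B a b : nat) :
  (delta <= p)%N -> a%:Z = A%:Z + 1 + e -> b%:Z = B%:Z - e ->
  let d := delta%:Z + p%:Z * e in
  chain_factor d A * chain_factor (- d) B * (1 - q ^ d) *
    ((-1) ^ e * q ^ (e * delta%:Z + p%:Z * tri e)) =
  qpoch (q ^+ delta) (q ^+ p) a * qpoch (q ^+ (p - delta)) (q ^+ p) b.
Proof.
move=> le_dp aE bE d.
pose w l := q ^ (delta%:Z + p%:Z * (l%:Z - b%:Z)).
have w_neq0 l : w l != 0 by rewrite expfz_neq0.
have invw l : 1 - (w l)^-1 = (- w l)^-1 * (1 - w l).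
  by field; rewrite oppr_eq0 w_neq0.
have eqN : (A.+1 + B = a + b)%N by lia.
have wV l : (w l)^-1 = q ^ (- (delta%:Z + p%:Z * (l%:Z - b%:Z))).
  by rewrite /w invr_expz.
have E1 : chain_factor (- d) B = (\prod_(l < B) (- w l))^-1 * \prod_(l < B) (1 - w l).
  rewrite /chain_factor (reindex_inj rev_ord_inj) /= -prodfV -big_split /=.
  apply: eq_bigr => l _; rewrite -invw wV; congr (1 - q ^ _).
  by rewrite -subSn // subSS /d -subzn 1?ltnW //; lia.
have E2 : (1 - q ^ d) * chain_factor d A = \prod_(l < A.+1) (1 - w (B + l)%N).
  rewrite big_ord_recl; congr (_ * _).
    by rewrite /w /d; congr (1 - q ^ (_ + _ * _)); rewrite addn0; lia.
  apply: eq_bigr => l _; rewrite /w /d lift0; congr (1 - q ^ _).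
  by rewrite PoszD bE; ring.
have E3 : qpoch (q ^+ (p - delta)) (q ^+ p) b =
    (\prod_(l < b) (- w l))^-1 * \prod_(l < b) (1 - w l).
  rewrite qpoch_expz (reindex_inj rev_ord_inj) /= -prodfV -big_split /=.
  apply: eq_bigr => l _; rewrite -invw wV; congr (1 - q ^ _).
  by rewrite -!subzn //; ring.
have E4 : qpoch (q ^+ delta) (q ^+ p) a = \prod_(l < a) (1 - w (b + l)%N).
  rewrite qpoch_expz; apply: eq_bigr => l _; rewrite /w; congr (1 - q ^ (_ + _ * _)).
  by rewrite PoszD addrAC subrr add0r.
have split_prod k l : \prod_(i < k) (1 - w i) * \prod_(i < l) (1 - w (k + i)%N) =
    \prod_(i < k + l) (1 - w i).
  by rewrite big_split_ord.
have E5 : (-1) ^ e * q ^ (e * delta%:Z + p%:Z * tri e) * \prod_(l < b) (- w l) =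
    \prod_(l < B) (- w l).
  have BE : B%:Z = e + b%:Z by rewrite bE addrC subrK.
  rewrite !prod_signed_expz mulrACA -expfzDr // !exprnP -expfzDr ?oppr_eq0 ?oner_eq0 //.
  by rewrite -BE BE triD; congr (_ * q ^ _); ring.
have prodw_neq0 k : \prod_(l < k) (- w l) != 0.
  by apply/prodf_neq0 => l _; rewrite oppr_eq0.
rewrite -mulrA mulrCA mulrC -!mulrA.
transitivity ((\prod_(l < b) (- w l))^-1 *
   ((-1) ^ e * q ^ (e * delta%:Z + p%:Z * tri e) * \prod_(l < b) (- w l)) *
   chain_factor (- d) B * ((1 - q ^ d) * chain_factor d A)).
  by field.
rewrite E5 E1 E2 E3 E4.
transitivity ((\prod_(l < b) (- w l))^-1 *
   (\prod_(i < B) (1 - w i) * \prod_(i < A.+1) (1 - w (B + i)%N))).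
  by field; rewrite !prodw_neq0.
rewrite split_prod addnC eqN addnC -split_prod; ring.
Qed.

Variables (n : nat) (c h : 'I_n -> nat).
Hypothesis c_lt : forall i, (c i < p)%N.
Let g i := (c i + p * h i)%N.
Hypothesis g_lt : forall i j : 'I_n, (i < j)%N -> (g i < g j < g i + p)%N.

(** A form of the chain product that has a limit: all bases are positive powers of [q]. Here [g i]
    is the end of chain [i] for the reference lengths [h]. As [g i < g j < g i + p] forces
    [h i <= h j <= h i + 1], the lengths involve no truncated subtraction. *)
Definition chain_den (rho : 'I_n -> nat) : F :=
  (\prod_i qpoch (q ^+ p) (q ^+ p) (rho i)) *
  \prod_(i < n) \prod_(j < n | (i < j)%N)
    (qpoch (q ^+ (g j - g i)) (q ^+ p) (rho j + h i + 1 - h j) *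
     qpoch (q ^+ (p - (g j - g i))) (q ^+ p) (rho i + h j - h i)).

(** Chains [i < j] contribute two strings of gaps with opposite offsets, and the extra pairwise gap
    is the factor missing between them. [chain_factor_pair] turns the three into Pochhammer symbols,
    up to a sign and a power of [q] quadratic in [s]. *)
Lemma chain_prodE (rho : 'I_n -> nat) (s : 'I_n -> int) :
  (forall i, (rho i)%:Z = (h i)%:Z + s i) -> \sum_i s i = 0 ->
  chain_prod q p c rho rho *
    (\prod_(i < n) \prod_(j < n | (i < j)%N)
       gap q (c i + p * rho i) (c j + p * rho j)) *
    q ^ (n%:Z * \sum_i ((g i)%:Z * s i) + n%:Z * p%:Z * \sum_i tri (s i)
         - p%:Z * \sum_(i < n) (i%:Z * s i)) =
  chain_den rho.
Proof.
move=> rhoE s0.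
have -> : q ^ (n%:Z * \sum_i ((g i)%:Z * s i) + n%:Z * p%:Z * \sum_i tri (s i)
         - p%:Z * \sum_(i < n) (i%:Z * s i)) =
  \prod_(i < n) \prod_(j < n | (i < j)%N) ((-1) ^ (s j - s i) *
     q ^ ((s j - s i) * (g j - g i)%N%:Z + p%:Z * tri (s j - s i))).
  rewrite -(@sum_ltn_tri _ _ (fun i => (g i)%:Z)) //.
  under [RHS]eq_bigr => i _ do rewrite big_split /= !prod_expz ?oppr_eq0 ?oner_eq0 //.
  rewrite big_split /= !prod_expz ?oppr_eq0 ?oner_eq0 // sum_ltn_sub //.
  (* The signs cancel: by [sum_ltn_sub] the sum of all [s j - s i] is even. *)
  rewrite -exprz_exp -exprnP sqrrN expr1n exp1rz mul1r; congr (q ^ _).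
  apply: eq_bigr => i _; apply: eq_bigr => j /g_lt/andP[lt_g _].
  by rewrite -subzn 1?ltnW.
pose y i := (c i + p * rho i)%N.
have factorE i j : \prod_(l < rho i) gap q (c i + p * l) (y j) =
    chain_factor ((y j)%:Z - (y i)%:Z) (rho i).
  rewrite (reindex_inj rev_ord_inj) /=; apply: eq_bigr => l _.
  rewrite /gap /y; congr (1 - q ^ _).
  by rewrite !PoszD !PoszM -subzn //; ring.
have -> : chain_prod q p c rho rho = \prod_i \prod_j chain_factor ((y j)%:Z - (y i)%:Z) (rho i).
  apply: eq_bigr => i _; rewrite exchange_big /=.
  by apply: eq_bigr => j _; exact: factorE.
rewrite big_pair_split /= /chain_den -!mulrA; congr (_ * _).
  apply: eq_bigr => i _; rewrite subrr qpoch_expz; apply: eq_bigr => l _.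
  by congr (1 - q ^ _); ring.
rewrite -!big_split /=; apply: eq_bigr => i _.
rewrite -!big_split /=; apply: eq_bigr => j lt_ij.
have /andP[lt_g lt_gp] := g_lt lt_ij.
pose d := (g j - g i)%N; pose e := s j - s i.
have yE : (y j)%:Z - (y i)%:Z = d%:Z + p%:Z * e.
  rewrite /d -subzn 1?ltnW // /y /g /e !PoszD !PoszM !rhoE; ring.
have yE' : (y i)%:Z - (y j)%:Z = - (d%:Z + p%:Z * e) by rewrite -yE opprB.
have hij : (h i <= h j <= (h i).+1)%N.
  move: lt_g lt_gp; rewrite /g; have := c_lt i; have := c_lt j; nia.
rewrite yE yE' /gap -/(y i) -/(y j) yE mulrA.
rewrite -/d -/e; apply: chain_factor_pair; first by rewrite /d leq_subLR ltnW.
  have := rhoE i; have := rhoE j; rewrite /e; lia.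
  have := rhoE i; have := rhoE j; rewrite /e; lia.
Qed.
End ChainProduct.

(** * Alternants and the sum over the affine Weyl group *)

Section Alternants.
Variables (F : fieldType) (n : nat).
Implicit Types (X : 'I_n.+1 -> F) (e : 'I_n.+1 -> nat).

Definition alternant e X : F :=
  \sum_(w : 'S_n.+1) (-1) ^+ w * \prod_i X i ^+ e (w i).

Lemma alternant_det e X : alternant e X = \det (\matrix_(i, j) X i ^+ e j).
Proof.
by apply: eq_bigr => w _; congr (_ * _); apply: eq_bigr => i _; rewrite mxE.
Qed.

Lemma alternant_Vandermonde X :
  alternant (@nat_of_ord _) X = \prod_(i < n.+1) \prod_(j < n.+1 | (i < j)%N) (X j - X i).
Proof.
rewrite alternant_det -det_tr.
have -> : (\matrix_(i, j) X i ^+ nat_of_ord j)^T = Vandermonde n.+1 (\row_i X i).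
  by apply/matrixP => i j; rewrite !mxE.
rewrite det_Vandermonde; apply: eq_bigr => i _; apply: eq_bigr => j _.
by rewrite !mxE.
Qed.

(** The staircase with its top raised by [k]: the quotient of its alternant by the Vandermonde
    product is the complete homogeneous function h_k. The same numbers are the chain starts of the
    second computation. *)
Definition hook_exp (k : nat) (i : 'I_n.+1) : nat := if i == ord_max then n + k else i.

(* The cofactor of the last column at row [i] is evaluated by replacing that
   column with the values of the monic polynomial [prod_(j != i) ('X - X_j)]. *)
Lemma alternant_hook (k : nat) X : injective X ->
  alternant (hook_exp k) X = alternant (@nat_of_ord _) X *
    \sum_i X i ^+ (n + k) / \prod_(j | j != i) (X i - X j).
Proof.
move=> X_inj.
pose V : 'M[F]_n.+1 := \matrix_(i, j) X i ^+ nat_of_ord j.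
pose C i := cofactor V i ord_max.
have C_orth (m : 'I_n.+1) : \sum_i C i * X i ^+ m = alternant (@nat_of_ord _) X * (m == ord_max)%:R.
  have := mul_adj_mx V => /matrixP/(_ ord_max m); rewrite !mxE alternant_det mulr_natr eq_sym.
  by move=> <-; apply: eq_bigr => i _; rewrite !mxE.
have C_E i0 : C i0 = alternant (@nat_of_ord _) X / \prod_(j | j != i0) (X i0 - X j).
  pose P : {poly F} := \prod_(j | j != i0) ('X - (X j)%:P).
  have sizeP : size P = n.+1.
    rewrite /P -big_filter size_prod_XsubC size_filter -sum1_count sum1_card.
    by rewrite cardC1 card_ord.
  have monP : P`_n = 1.
    have /monicP : P \is monic by apply: monic_prod => j _; rewrite monicXsubC.
    by rewrite /lead_coef sizeP.
  have hornerP i : P.[X i] = \prod_(j | j != i0) (X i - X j).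
    by rewrite horner_prod; apply: eq_bigr => j _; rewrite hornerXsubC.
  have prod_neq0 : \prod_(j | j != i0) (X i0 - X j) != 0.
    apply/prodf_neq0 => j ne_j; rewrite subr_eq0 eq_sym (inj_eq X_inj) //.
  apply: (mulIf prod_neq0); rewrite divfK // -hornerP.
  transitivity (\sum_i C i * P.[X i]).
    rewrite (bigD1 i0) //= big1 ?addr0 // => i ne_i.
    by rewrite hornerP (bigD1 i) //= subrr mul0r mulr0.
  under eq_bigr => i _ do rewrite (horner_coef_wide _ (eq_leq sizeP)) mulr_sumr.
  rewrite exchange_big /= (bigD1 ord_max) //= [X in _ + X]big1 ?addr0.
    under eq_bigr => i _ do rewrite monP mul1r.
    by rewrite (C_orth ord_max) eqxx mulr1.
  move=> m ne_m; under eq_bigr => i _ do rewrite mulrCA.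
  by rewrite -mulr_sumr C_orth (negPf ne_m) !mulr0.
rewrite alternant_det (expand_det_col _ ord_max) mulr_sumr; apply: eq_bigr => i _.
rewrite mxE /hook_exp eqxx [RHS]mulrCA -C_E; congr (_ * _).
congr (_ * \det _); apply/matrixP => i' j'; rewrite !mxE.
by rewrite eq_sym (negPf (neq_lift _ _)).
Qed.

Variables (q : F).
Hypotheses (q_neq0 : q != 0) (q_nroot : forall a, (0 < a)%N -> q ^+ a != 1).

Definition ltn_sign : F := \prod_(i < n.+1) \prod_(j < n.+1 | (i < j)%N) (-1).

Lemma prod_gap_ltn (y : 'I_n.+1 -> nat) :
  \prod_(i < n.+1) \prod_(j < n.+1 | (i < j)%N) gap q (y i) (y j) =
  ltn_sign * (\prod_(i < n.+1) (q ^+ y i) ^- (n - i)) *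
    alternant (@nat_of_ord _) (fun i => q ^+ y i).
Proof.
rewrite alternant_Vandermonde -!big_split /=; apply: eq_bigr => i _.
have -> : (q ^+ y i) ^- (n - i) = \prod_(j < n.+1 | (i < j)%N) (q ^+ y i)^-1.
  by rewrite prodr_const card_ord_gtn subSS exprVn.
rewrite -!big_split /=; apply: eq_bigr => j _; rewrite gapE //; ring.
Qed.

(** Passing from gaps to differences multiplies the term of [i] by [(q ^+ y i) ^+ n], so the power
    [k] becomes [n + k], the top exponent of [hook_exp]. *)
Lemma prod_gap_next (k : nat) (y : 'I_n.+1 -> nat) : injective y ->
  (\prod_(i < n.+1) \prod_(j < n.+1 | (i < j)%N) gap q (y i) (y j)) *
    \sum_i (q ^+ y i) ^+ k / \prod_(j | j != i) gap q (y i) (y j) =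
  ltn_sign * (\prod_(i < n.+1) (q ^+ y i) ^- (n - i)) *
    alternant (hook_exp k) (fun i => q ^+ y i).
Proof.
move=> y_inj; rewrite prod_gap_ltn -!mulrA; congr (_ * (_ * _)).
rewrite alternant_hook; last by move=> i j /(expr_inj q_neq0 q_nroot)/y_inj.
congr (_ * _); apply: eq_bigr => i _.
have -> : \prod_(j | j != i) gap q (y i) (y j) =
    (\prod_(j | j != i) (q ^+ y i - q ^+ y j)) / (q ^+ y i) ^+ n.
  under eq_bigr => j _ do rewrite gapE //.
  by rewrite big_split /= prodr_const cardC1 card_ord exprVn.
by rewrite invf_div mulrA addnC exprD.
Qed.

(** The part of the affine Weyl group sum with translation [s]; the finite Weyl group enters through
    [w]. *)
Definition lattice_term (N : nat) (u v : 'S_n.+1 -> 'I_n.+1 -> nat) (s : 'I_n.+1 -> int) : F :=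
  \sum_(w : 'S_n.+1) (-1) ^+ w *
    q ^ (N%:Z * \sum_i tri (s i) + \sum_i ((u w i)%:Z * s i + (v w i)%:Z)).

(** Translations with coordinates in [-D, D], stored with offset [D]. Permuting coordinates
    preserves the box, which makes [box_sum_sym] exact for each [D]. *)
Definition box_sum (D : nat) (V : ('I_n.+1 -> int) -> F) : F :=
  \sum_(sg : {ffun 'I_n.+1 -> 'I_(D.*2.+1)} | \sum_i ((sg i)%:Z - D%:Z) == 0)
    V (fun i => (sg i)%:Z - D%:Z).

(* Both sides sum over the affine Weyl group; the second one is the first one
   with each element replaced by its inverse. *)
Lemma box_sum_sym (e : 'I_n.+1 -> nat) (N a b D : nat) :
  box_sum D (lattice_term N (fun w i => a * i + b * e (w i))%N (fun w i => e (w i) * i)%N) =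
  box_sum D (lattice_term N (fun w i => a * w i + b * e i)%N (fun w i => e i * w i)%N).
Proof.
rewrite /box_sum /lattice_term exchange_big [RHS]exchange_big /=.
rewrite [RHS](reindex_inj (@invg_inj _)) /=; apply: eq_bigr => w _.
pose act (u : 'S_n.+1) (sg : {ffun 'I_n.+1 -> 'I_(D.*2.+1)}) := [ffun i => sg (u i)].
rewrite (reindex (act w)) /=; last first.
  exists (act w^-1%g) => sg _; apply/ffunP => i; rewrite !ffunE; congr (sg _).
    by rewrite -permM mulVg perm1.
  by rewrite -permM mulgV perm1.
have reind (f : 'I_n.+1 -> int) : \sum_i f (w i) = \sum_i f i.
  by rewrite [RHS](reindex_inj (@perm_inj _ w)).
apply: eq_big => sg.
  under eq_bigr => i _ do rewrite ffunE.
  by rewrite (reind (fun i => (sg i)%:Z - D%:Z)).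
move=> _; rewrite odd_permV; congr (_ * q ^ (_ * _ + _)).
  under eq_bigr => i _ do rewrite ffunE.
  by rewrite (reind (fun i => tri ((sg i)%:Z - D%:Z))).
rewrite [RHS](reindex_inj (@perm_inj _ w)) /=.
by apply: eq_bigr => i _; rewrite ffunE permK.
Qed.

End Alternants.

(** * Bounds on exponents *)

Section Growth.

Lemma tri_ge (z : int) (a : int) : 2 * a <= z * (z - 1) -> a <= tri z.
Proof. by rewrite -triE; lia. Qed.

Lemma quad_lower (N U u : nat) (s : int) : (0 < N)%N -> (u <= U)%N ->
  - (U ^ 2)%N%:Z <= N%:Z * tri s + u%:Z * s.
Proof.
move=> N_gt0 le_uU.
have tri_ge0 : 0 <= tri s by apply: tri_ge; nia.
have [s_ge0|s_lt0] := leP 0 s; first by nia.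
have tri_le : tri s <= N%:Z * tri s by nia.
have : - (U%:Z * U%:Z) <= tri s + U%:Z * s.
  have := triE s; nia.
nia.
Qed.

Lemma quad_large (N U u T D : nat) (s : int) : (0 < N)%N -> (u <= U)%N ->
  (2 * U + 2 * T + 2 <= D)%N -> (D%:Z < s \/ s < - D%:Z) ->
  T%:Z <= N%:Z * tri s + u%:Z * s.
Proof.
move=> N_gt0 le_uU le_D s_out.
have tri_ge0 : 0 <= tri s by apply: tri_ge; nia.
have tri_le : tri s <= N%:Z * tri s by nia.
case: s_out => s_out; have := triE s; nia.
Qed.

Lemma quad_sum_large (n N U d : nat) : (0 < N)%N -> exists D0, forall D, (D0 <= D)%N ->
  forall (u v : 'I_n -> nat) (s : 'I_n -> int), (forall i, u i <= U)%N ->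
  (exists i, D%:Z < s i \/ s i < - D%:Z) ->
  d%:Z <= N%:Z * \sum_i tri (s i) + \sum_i ((u i)%:Z * s i + (v i)%:Z).
Proof.
(* The coordinate outside the box contributes at least [d + n * U ^ 2], each other one at least
   [- U ^ 2]. *)
move=> N_gt0; exists (2 * U + 2 * (d + n * U ^ 2) + 2)%N => D le_D u v s le_u [i0 s_out].
rewrite mulr_sumr -big_split /= (bigD1 i0) //=.
have le_i0 : (d + n * U ^ 2)%N%:Z <= N%:Z * tri (s i0) + ((u i0)%:Z * s i0 + (v i0)%:Z).
  have := quad_large N_gt0 (le_u i0) le_D s_out; lia.
have le_rest : - (n * U ^ 2)%N%:Z <=
    \sum_(i | i != i0) (N%:Z * tri (s i) + ((u i)%:Z * s i + (v i)%:Z)).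
  apply: (@le_trans _ _ (\sum_(i | i != i0) - (U ^ 2)%N%:Z)).
    rewrite sumr_const cardC1 card_ord -mulr_natl natz PoszM.
    by have := ltn_ord i0; nia.
  by apply: ler_sum => i _; have := quad_lower (s i) N_gt0 (le_u i); lia.
by move: (lerD le_i0 le_rest); rewrite PoszD addrK.
Qed.

Lemma quad_sum_lower (n N U : nat) (u v : 'I_n -> nat) (s : 'I_n -> int) :
  (0 < N)%N -> (forall i, u i <= U)%N ->
  - (n * U ^ 2)%N%:Z <= N%:Z * \sum_i tri (s i) + \sum_i ((u i)%:Z * s i + (v i)%:Z).
Proof.
move=> N_gt0 le_u; rewrite mulr_sumr -big_split /=.
apply: (@le_trans _ _ (\sum_(i < n) - (U ^ 2)%N%:Z)).
  by rewrite sumr_const card_ord -mulr_natl natz PoszM mulrN.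
by apply: ler_sum => i _; have := quad_lower (s i) N_gt0 (le_u i); lia.
Qed.

(** A largest value is at least [#|J| - 1], since the other values are distinct and below it;
    induction removes it. *)
Lemma sum_ge_binomial (T : finType) (e : T -> nat) (J : {set T}) :
  {in J &, injective e} -> ('C(#|J|, 2) <= \sum_(a in J) e a)%N.
Proof.
move: {2}#|J| (erefl #|J|) => k; elim: k J => [|k IHk] J cardJ e_inj; first by rewrite cardJ.
have [a0 a0J] : exists a, a \in J by apply/set0Pn; rewrite -card_gt0 cardJ.
case: (@arg_maxnP _ a0 [in J] e a0J) => a aJ max_a.
have {}max_a b : b \in J -> (e b <= e a)%N by exact: max_a.
have {}aJ : a \in J by exact: aJ.
have cardD : #|J :\ a| = k by have := cardsD1 a J; rewrite aJ cardJ add1n => -[].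
rewrite (big_setD1 a aJ) /= cardJ binS bin1 addnC -cardD leq_add //; last first.
  by apply: IHk => // b c /setD1P[_ bJ] /setD1P[_ cJ]; exact: e_inj.
rewrite -[X in (_ <= X)%N](@card_ord_ltn (e a).+1) //.
rewrite -(@card_in_imset _ _ (fun b => inord (e b) : 'I_(e a).+1) (J :\ a)); last first.
  move=> b c /setD1P[_ bJ] /setD1P[_ cJ] /(congr1 val) /=.
  by rewrite !inordK ?ltnS ?max_a //; exact: e_inj.
apply/subset_leq_card/subsetP => l /imsetP[b /setD1P[ne_ba bJ] ->].
rewrite inE inordK ?ltnS ?max_a // ltn_neqAle max_a // andbT.
by apply: contraNneq ne_ba => /e_inj ->.
Qed.

End Growth.

(** * The summands as functions of the lattice vector *)

Section Residues.
Variable n : nat.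

Definition chain_weight (p : nat) (c rho : 'I_n.+1 -> nat) : nat :=
  \sum_i \sum_(l < rho i) (c i + p * l).

Lemma chain_weightE (p : nat) (c rho : 'I_n.+1 -> nat) :
  (chain_weight p c rho)%:Z =
  \sum_i ((c i)%:Z * (rho i)%:Z + p%:Z * tri (rho i)%:Z).
Proof.
rewrite /chain_weight (big_morph Posz PoszD (erefl _)); apply: eq_bigr => i _.
elim: (rho i) => [|l IHl]; first by rewrite big_ord0 /tri !mul0r div0z !mulr0 addr0.
by rewrite big_ord_recr /= PoszD IHl triS -addn1 !PoszD PoszM; ring.
Qed.

Lemma chain_weight_shift (p : nat) (c h rho : 'I_n.+1 -> nat) (s : 'I_n.+1 -> int) :
  (forall i, (rho i)%:Z = (h i)%:Z + s i) ->
  (chain_weight p c rho)%:Z = (chain_weight p c h)%:Z +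
    \sum_i ((c i + p * h i)%N%:Z * s i + p%:Z * tri (s i)).
Proof.
move=> rhoE; rewrite !chain_weightE -big_split /=; apply: eq_bigr => i _.
by rewrite rhoE triD PoszD PoszM; ring.
Qed.

Lemma chain_weight_ge (p : nat) (c rho : 'I_n.+1 -> nat) :
  (0 < p)%N -> (forall i, (c i < p)%N) -> injective c ->
  ('C(\sum_i rho i, 2) <= chain_weight p c rho)%N.
Proof.
move=> p_gt0 c_lt c_inj; pose M := (\sum_i rho i)%N.
have rho_le i : (rho i <= M)%N by rewrite /M (bigD1 i) //= leq_addr.
have -> : chain_weight p c rho = (\sum_(b in chain_set M rho) chain_exp p c b)%N.
  rewrite big_chain_set /=; apply: eq_bigr => i _.
  by rewrite (big_ord_widen M (fun l => c i + p * l)%N).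
rewrite -(card_chain_set rho_le); apply: sum_ge_binomial => b b' _ _.
exact: chain_exp_inj.
Qed.

Lemma hook_exp_sum (k : nat) : (\sum_i @hook_exp n k i = \sum_(i < n.+1) (n - i) + k)%N.
Proof.
rewrite [in RHS](reindex_inj rev_ord_inj) /= !(big_ord_recr n) /= {2}/hook_exp eqxx.
rewrite subSS subnn subn0 addnA; congr (_ + _ + _)%N; apply: eq_bigr => i _.
rewrite /hook_exp ifF /=; first by have := ltn_ord i; lia.
by rewrite -val_eqE /= ltn_eqF.
Qed.

(** Chain [i] is the residue class of [r + i]. In this order {0, ..., r-1} has chain lengths
    [residue_quo r i] and chain ends r, r + 1, ..., r + n, whose differences do not depend on
    [r]. *)
Definition residue (r : nat) (i : 'I_n.+1) : nat := (r + i) %% n.+1.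
Definition residue_quo (r : nat) (i : 'I_n.+1) : nat := (r + i) %/ n.+1.

Lemma residueE (r : nat) (i : 'I_n.+1) :
  (residue r i + n.+1 * residue_quo r i = r + i)%N.
Proof. by rewrite addnC mulnC -divn_eq. Qed.

Lemma residue_lt (r : nat) (i : 'I_n.+1) : (residue r i < n.+1)%N.
Proof. exact: ltn_pmod. Qed.

Lemma residue_inj (r : nat) : injective (residue r).
Proof.
move=> i j /eqP; rewrite /residue eqn_modDl !modn_small // => /eqP; exact: val_inj.
Qed.

(** From [r] to [r + 1] the window of length [n.+1] loses [phi r] and gains [phi (r + n.+1)], a
    change of [psi r]. *)
Lemma sum_shift (phi : nat -> nat) (psi : nat -> nat) :
  (forall x, phi (x + n.+1) = phi x + psi x)%N -> (forall x, (x < n.+1)%N -> phi x = 0%N) ->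
  forall r, (\sum_(i < n.+1) phi (r + i) = \sum_(x < r) psi x)%N.
Proof.
move=> phiS phi0; elim=> [|r IHr].
  by rewrite big_ord0 big1 // => i _; rewrite add0n phi0.
rewrite [RHS]big_ord_recr /= -IHr.
rewrite big_ord_recr [X in _ = (X + _)%N]big_ord_recl /= addn0 addSnnS phiS.
rewrite addnA; congr (_ + _)%N; rewrite addnC; congr (_ + _)%N.
by apply: eq_bigr => i _; rewrite /bump /= add1n addnS.
Qed.

Lemma sum_residue_quo (r : nat) : (\sum_i residue_quo r i = r)%N.
Proof.
rewrite (@sum_shift (fun x => x %/ n.+1)%N (fun=> 1%N)).
- by rewrite sum_nat_const card_ord muln1.
- by move=> x; rewrite divnDr ?divnn.
- by move=> x; exact: divn_small.
Qed.

Lemma chain_weight_residue (r : nat) : chain_weight n.+1 (residue r) (residue_quo r) = 'C(r, 2).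
Proof.
pose phi x := (\sum_(l < x %/ n.+1) (x %% n.+1 + n.+1 * l))%N.
rewrite -(triangular_sum r) big_mkord; apply: (@sum_shift phi id) => x; rewrite /phi.
  rewrite modnDr divnDr // divnn /= addn1 big_ord_recr /=; congr (_ + _)%N.
  by rewrite addnC mulnC -divn_eq.
by move=> lt_x; rewrite divn_small // big_ord0.
Qed.

Lemma hook_exp_mono (k : nat) (i j : 'I_n.+1) : (i < j)%N -> (hook_exp k i < hook_exp k j)%N.
Proof.
move=> lt_ij; have lt_jn := ltn_ord j.
rewrite /hook_exp ifF; last by apply/eqP => eq_i; rewrite eq_i /= in lt_ij; lia.
by case: eqP => [|//]; lia.
Qed.

Lemma hook_exp_inj (k : nat) : injective (@hook_exp n k).
Proof.
move=> i j eq_ij; apply: val_inj; apply/eqP.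
by case: (ltngtP i j) => // /(hook_exp_mono k); rewrite eq_ij ltnn.
Qed.

Lemma hook_exp_lt (m k : nat) (i : 'I_n.+1) : (k <= m)%N -> (hook_exp k i < m + n.+1)%N.
Proof. by move=> le_km; have := ltn_ord i; rewrite /hook_exp; case: eqP; lia. Qed.

(** Writing [n - i] as a difference, the zero sum of [s] removes the part with [n]. The last term
    later cancels the negative one in the exponent of [chain_prodE]. *)
Lemma sum_exponent_expand (e b s : 'I_n.+1 -> int) (a p : int) : \sum_i s i = 0 ->
  \sum_i (e i - (n - i)%N%:Z) * (a + b i + p * s i) =
  a * (\sum_i e i - (\sum_(i < n.+1) (n - i))%N%:Z) +
    \sum_i e i * b i - \sum_(i < n.+1) (n - i)%N%:Z * b i +
    p * (\sum_i e i * s i) + p * (\sum_(i < n.+1) i%:Z * s i).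
Proof.
move=> s0; rewrite (big_morph Posz PoszD (erefl _)).
transitivity (\sum_(i < n.+1) (a * (e i - (n - i)%N%:Z) + e i * b i - (n - i)%N%:Z * b i +
    p * (e i * s i) + p * (i%:Z * s i) - (p * n%:Z) * s i)).
  apply: eq_bigr => i _; have -> : (n - i)%N%:Z = n%:Z - i%:Z.
    by rewrite subzn // -ltnS.
  by ring.
by rewrite !(sumrB, big_split) /= -!mulr_sumr s0 mulr0 subr0 sumrB.
Qed.

End Residues.

Section ChainTerms.
Variables (F : fieldType) (q : F).
Hypotheses (q_neq0 : q != 0) (q_nroot : forall a, (0 < a)%N -> q ^+ a != 1).

Lemma q_expn_nroot (p : nat) : (0 < p)%N -> forall a, (0 < a)%N -> (q ^+ p) ^+ a != 1.
Proof. by move=> p_gt0 a a_gt0; rewrite -exprM q_nroot // muln_gt0 p_gt0. Qed.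

Variable n : nat.

Definition chain_next (p k : nat) (c rho : 'I_n.+1 -> nat) : F :=
  \sum_i (q ^+ (c i + p * rho i)) ^+ k /
     \prod_(j | j != i) gap q (c i + p * rho i) (c j + p * rho j).

Lemma chain_prod_neq0 (p : nat) (c rho : 'I_n.+1 -> nat) :
  (0 < p)%N -> (forall i, (c i < p)%N) -> injective c ->
  chain_prod q p c rho rho != 0.
Proof.
move=> p_gt0 c_lt c_inj; apply/prodf_neq0 => i _; apply/prodf_neq0 => l _.
apply/prodf_neq0 => j _; rewrite gap_eq0 //.
exact: (chain_end_neq p_gt0 c_lt c_inj (ltn_ord l) (leqnn _)).
Qed.

(** A prefactor shared by the two computations, so that it drops out of their comparison. *)
Definition lattice_const : F :=
  ltn_sign F n * q ^- (\sum_(i < n.+1) (n - i) * i)%N.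

(** The two alternating sums are compared permutation by permutation, which leaves an identity
    between integer exponents. *)
Lemma lattice_term_alternant (N : nat) (e0 : int) (e : 'I_n.+1 -> nat) (y : 'I_n.+1 -> nat)
    (u v : 'S_n.+1 -> 'I_n.+1 -> nat) (s : 'I_n.+1 -> int) (e1 : int) :
  (forall w : 'S_n.+1, e0 + \sum_i ((e (w i))%:Z - (n - i)%N%:Z) * (y i)%:Z =
     e1 - (\sum_(i < n.+1) (n - i) * i)%N%:Z +
     (N%:Z * \sum_i tri (s i) + \sum_i ((u w i)%:Z * s i + (v w i)%:Z))) ->
  q ^ e0 * (ltn_sign F n * (\prod_(i < n.+1) (q ^+ y i) ^- (n - i)) *
    alternant e (fun i => q ^+ y i)) =
  q ^ e1 * lattice_const * lattice_term q N u v s.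
Proof.
move=> expE; rewrite /lattice_const /lattice_term /alternant.
rewrite -!mulrA [LHS]mulrCA [RHS]mulrCA; congr (_ * _).
have mul2 (a b : F) (f : 'S_n.+1 -> F) : a * (b * \sum_w f w) = \sum_w a * (b * f w).
  by rewrite !mulr_sumr.
rewrite !mul2; apply: eq_bigr => w _.
rewrite ![_ * ((-1) ^+ w * _)]mulrCA; congr (_ * _).
have -> : q ^- (\sum_(i < n.+1) (n - i) * i) = q ^ (- (\sum_(i < n.+1) (n - i) * i)%N%:Z).
  by rewrite -invr_expz.
have {}expE := expE w; rewrite -addrA in expE.
rewrite -!expfzDr // -expE expfzDr //; congr (_ * _).
rewrite -prod_expz // -big_split /=; apply: eq_bigr => i _.
rewrite -!exprM mulrBl expfzDr // mulrC -PoszM -invr_expz -exprnP mulnC; congr (_ * _).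
by rewrite -PoszM -exprnP mulnC.
Qed.


Section ChainTerm.
Variables (p k : nat) (c h rho : 'I_n.+1 -> nat) (s : 'I_n.+1 -> int).
Hypotheses (p_gt0 : (0 < p)%N) (c_lt : forall i, (c i < p)%N) (c_inj : injective c).
Hypothesis g_lt : forall i j : 'I_n.+1, (i < j)%N ->
  (c i + p * h i < c j + p * h j < c i + p * h i + p)%N.
Hypotheses (rhoE : forall i, (rho i)%:Z = (h i)%:Z + s i) (s0 : \sum_i s i = 0).
Let y i := (c i + p * rho i)%N.
Let mono : int :=
  n.+1%:Z * \sum_i ((c i + p * h i)%N%:Z * s i) + n.+1%:Z * p%:Z * \sum_i tri (s i)
         - p%:Z * \sum_(i < n.+1) (i%:Z * s i).

Lemma chain_prod_invE (z : F) :
  z / chain_prod q p c rho rho =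
  q ^ mono * ((\prod_(i < n.+1) \prod_(j < n.+1 | (i < j)%N) gap q (y i) (y j)) * z) /
    chain_den q p c h rho.
Proof.
have cp0 := chain_prod_neq0 rho p_gt0 c_lt c_inj.
rewrite -(chain_prodE q_neq0 c_lt g_lt rhoE s0) -/mono.
have gap0 : \prod_(i < n.+1) \prod_(j < n.+1 | (i < j)%N)
    gap q (c i + p * rho i) (c j + p * rho j) != 0.
  apply/prodf_neq0 => i _; apply/prodf_neq0 => j lt_ij; rewrite gap_eq0 //.
  apply/eqP => /(congr1 (modn^~ p)).
  rewrite /= ![(p * _)%N]mulnC ![(c _ + _)%N]addnC !modnMDl !modn_small // => /c_inj eq_ij.
  by rewrite eq_ij ltnn in lt_ij.
have qm0 : q ^ mono != 0 by rewrite expfz_neq0.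
by rewrite /y; field; rewrite cp0 gap0 qm0.
Qed.

Lemma chain_end_inj : injective y.
Proof.
move=> i j /(congr1 (modn^~ p)).
by rewrite /y /= ![(p * _)%N]mulnC ![(c _ + _)%N]addnC !modnMDl !modn_small // => /c_inj.
Qed.

Lemma chain_next_divE :
  chain_next p k c rho / chain_prod q p c rho rho =
  q ^ mono * (ltn_sign F n * (\prod_(i < n.+1) (q ^+ y i) ^- (n - i)) *
    alternant (@hook_exp n k) (fun i => q ^+ y i)) / chain_den q p c h rho.
Proof. by rewrite chain_prod_invE prod_gap_next //; exact: chain_end_inj. Qed.

Lemma chain_prod_inv_alternant :
  (chain_prod q p c rho rho)^-1 =
  q ^ mono * (ltn_sign F n * (\prod_(i < n.+1) (q ^+ y i) ^- (n - i)) *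
    alternant (@nat_of_ord _) (fun i => q ^+ y i)) / chain_den q p c h rho.
Proof. by rewrite -[LHS]mul1r chain_prod_invE prod_gap_ltn // mulr1. Qed.
End ChainTerm.

(** The reference chain ends are [r + i], so outside the denominator [r] enters only through the
    prefactor: [m * 'C(r, 2)] is [m] times the sum of {0, ..., r-1}, and [k * r] appears because the
    hook exponents sum to [k] more than the staircase. In the quadratic form, [n.+1 * m] comes from
    the weight and [n.+1 * n.+1] from the chain product. *)
Lemma chain_term_residue (m k r : nat) (rho : 'I_n.+1 -> nat) (s : 'I_n.+1 -> int) :
  (forall i, (rho i)%:Z = (residue_quo r i)%:Z + s i) -> \sum_i s i = 0 ->
  q ^+ (m * chain_weight n.+1 (residue r) rho) *
    (chain_next n.+1 k (residue r) rho / chain_prod q n.+1 (residue r) rho rho) =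
  q ^+ (m * 'C(r, 2) + k * r) * lattice_const *
    lattice_term q (n.+1 * (m + n.+1))
      (fun w i => (m + n.+1) * i + n.+1 * hook_exp k (w i))%N
      (fun w i => hook_exp k (w i) * i)%N s /
    chain_den q n.+1 (residue r) (residue_quo r) rho.
Proof.
move=> rhoE s0.
rewrite (chain_next_divE k (h := residue_quo r) (s := s)) //; first last.
- move=> i j lt_ij; rewrite !residueE; have := ltn_ord j; lia.
- exact: residue_inj.
- exact: residue_lt.
rewrite mulrA exprnP mulrA -expfzDr // exprnP; congr (_ / _).
apply: lattice_term_alternant => // w.
rewrite PoszM (chain_weight_shift _ _ rhoE) chain_weight_residue.
under [X in _ + X = _]eq_bigr => i _.
  have -> : (residue r i + n.+1 * rho i)%N%:Z = r%:Z + i%:Z + n.+1%:Z * s i.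
    by rewrite -PoszD -residueE !(PoszD, PoszM) rhoE; ring.
  over.
rewrite (@sum_exponent_expand n (fun i => (hook_exp k (w i))%:Z) (fun i => i%:Z)) //.
have -> : \sum_i (hook_exp k (w i))%:Z = (\sum_(i < n.+1) (n - i) + k)%N%:Z.
  rewrite -hook_exp_sum (big_morph Posz PoszD (erefl _)).
  by rewrite [RHS](reindex_inj (@perm_inj _ w)).
have gs : \sum_i ((residue r i + n.+1 * residue_quo r i)%N%:Z * s i) = \sum_(i < n.+1) i%:Z * s i.
  transitivity (\sum_(i < n.+1) (r%:Z * s i + i%:Z * s i)).
    by apply: eq_bigr => i _; rewrite residueE PoszD mulrDl.
  by rewrite big_split /= -mulr_sumr s0 mulr0 add0r.
have -> : \sum_i ((residue r i + n.+1 * residue_quo r i)%N%:Z * s i + n.+1%:Z * tri (s i)) =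
    \sum_(i < n.+1) i%:Z * s i + n.+1%:Z * \sum_i tri (s i).
  by rewrite big_split /= gs -mulr_sumr.
have -> : \sum_(i < n.+1) (((m + n.+1) * i + n.+1 * hook_exp k (w i))%N%:Z * s i +
      (hook_exp k (w i) * i)%N%:Z) =
    (m%:Z + n.+1%:Z) * (\sum_(i < n.+1) i%:Z * s i) +
    n.+1%:Z * (\sum_(i < n.+1) (hook_exp k (w i))%:Z * s i) +
    \sum_(i < n.+1) (hook_exp k (w i))%:Z * i%:Z.
  rewrite !mulr_sumr -!big_split /=; apply: eq_bigr => i _.
  by rewrite !(PoszD, PoszM); ring.
have -> : (\sum_(i < n.+1) (n - i) * i)%N%:Z = \sum_(i < n.+1) (n - i)%N%:Z * i%:Z.
  by rewrite (big_morph Posz PoszD (erefl _)).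
by rewrite gs !(PoszD, PoszM); ring.
Qed.

(** All chains have the same reference length and there is no weight. The hook exponents are now the
    chain starts and the permuted exponents are the plain staircase, which exchanges the roles of
    [i] and [w i]. *)
Lemma chain_term_hook (m k H : nat) (rho : 'I_n.+1 -> nat) (s : 'I_n.+1 -> int) :
  (k <= m)%N ->
  (forall i, (rho i)%:Z = H%:Z + s i) -> \sum_i s i = 0 ->
  (chain_prod q (m + n.+1) (@hook_exp n k) rho rho)^-1 =
  lattice_const * lattice_term q (n.+1 * (m + n.+1))
      (fun w i => (m + n.+1) * w i + n.+1 * hook_exp k i)%N
      (fun w i => hook_exp k i * w i)%N s /
    chain_den q (m + n.+1) (@hook_exp n k) (fun=> H) rho.
Proof.
move=> le_km rhoE s0; have hook_lt (i : 'I_n.+1) := hook_exp_lt i le_km.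
rewrite (chain_prod_inv_alternant (h := fun=> H) (s := s)) //; first last.
- move=> i j lt_ij; have := hook_exp_mono k lt_ij; have := hook_lt j; lia.
- exact: hook_exp_inj.
- by rewrite addn_gt0 orbT.
rewrite -[lattice_const]mul1r -(expr0z q); congr (_ / _).
apply: lattice_term_alternant => // w.
under [X in _ + X = _]eq_bigr => i _.
  have -> : (hook_exp k i + (m + n.+1) * rho i)%N%:Z =
      (m%:Z + n.+1%:Z) * H%:Z + (hook_exp k i)%:Z + (m%:Z + n.+1%:Z) * s i.
    by rewrite !(PoszD, PoszM) rhoE; ring.
  over.
rewrite (@sum_exponent_expand n (fun i => (w i)%:Z) (fun i => (hook_exp k i)%:Z)) //.
have -> : \sum_i (w i)%:Z = (\sum_(i < n.+1) (n - i))%N%:Z.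
  have -> : (\sum_(i < n.+1) (n - i) = \sum_(i < n.+1) i)%N.
    rewrite [RHS](reindex_inj rev_ord_inj); apply: eq_bigr => i _ /=; lia.
  rewrite (big_morph Posz PoszD (erefl _)).
  by rewrite [RHS](reindex_inj (@perm_inj _ w)).
have -> : \sum_i ((hook_exp k i + (m + n.+1) * H)%N%:Z * s i) =
    \sum_(i < n.+1) (hook_exp k i)%:Z * s i.
  transitivity (\sum_(i < n.+1) ((hook_exp k i)%:Z * s i + ((m + n.+1) * H)%N%:Z * s i)).
    by apply: eq_bigr => i _; rewrite PoszD mulrDl.
  by rewrite big_split /= -[X in _ + X]mulr_sumr s0 mulr0 addr0.
have -> : \sum_(i < n.+1) (((m + n.+1) * w i + n.+1 * hook_exp k i)%N%:Z * s i +
      (hook_exp k i * w i)%N%:Z) =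
    (m%:Z + n.+1%:Z) * (\sum_(i < n.+1) (w i)%:Z * s i) +
    n.+1%:Z * (\sum_(i < n.+1) (hook_exp k i)%:Z * s i) +
    \sum_(i < n.+1) (w i)%:Z * (hook_exp k i)%:Z.
  rewrite !mulr_sumr -!big_split /=; apply: eq_bigr => i _.
  by rewrite !(PoszD, PoszM); ring.
(* The raised exponent has coefficient [n - n = 0]; hence the same [lattice_const] as in the first
   computation. *)
have -> : (\sum_(i < n.+1) (n - i) * i)%N%:Z = \sum_(i < n.+1) (n - i)%N%:Z * (hook_exp k i)%:Z.
  rewrite (big_morph Posz PoszD (erefl _)); apply: eq_bigr => i _.
  rewrite PoszM /hook_exp; case: eqP => [->|//].
  by rewrite subnn !mul0r.
by rewrite !(PoszD, PoszM); ring.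
Qed.

End ChainTerms.

(** * Chains cut off at N variables and finite sums over chain lengths *)

Section ChainLength.
Variable n : nat.

(** The number of exponents below [N] in the class of chain [i]; adding [n] rounds the quotient
    up. *)
Definition chain_len (N r : nat) (i : 'I_n.+1) : nat := (N + n - residue r i) %/ n.+1.

Lemma ltn_chain_len (N r : nat) (i : 'I_n.+1) (l : nat) :
  (l < chain_len N r i)%N = (residue r i + n.+1 * l < N)%N.
Proof.
have := residue_lt r i; rewrite ltnS => le_c.
rewrite /chain_len leq_divRL // mulSn [(l * _)%N]mulnC; lia.
Qed.

Lemma chain_len_le (N r : nat) (i : 'I_n.+1) : (chain_len N r i <= N)%N.
Proof. by rewrite leqNgt ltn_chain_len -leqNgt mulSn; lia. Qed.

Lemma ex_chain_index (N r : nat) : exists2 f : 'I_N -> 'I_n.+1 * 'I_N,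
  forall a, chain_exp n.+1 (residue r) (f a) = a &
  f @: setT = chain_set N (chain_len N r).
Proof.
have lt_div (a : 'I_N) : (a %/ n.+1 < N)%N by rewrite (leq_ltn_trans (leq_div _ _)).
(* Modulo [n.+1], [a + n * r] is [a - r], the number of the chain through [a]. *)
pose f (a : 'I_N) : 'I_n.+1 * 'I_N :=
  (Ordinal (ltn_pmod (a + n * r) (ltn0Sn n)), Ordinal (lt_div a)).
have fE a : chain_exp n.+1 (residue r) (f a) = a.
  rewrite /chain_exp /residue /= modnDmr addnCA -mulSn addnC mulnC [(n.+1 * r)%N]mulnC.
  by rewrite [(a + _)%N]addnC modnMDl -divn_eq.
exists f => //; apply/setP => -[i l]; rewrite !inE /= ltn_chain_len.
apply/imsetP/idP => [[a _ eq_f]|lt_e].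
  by have := fE a; rewrite -eq_f /chain_exp /= => ->.
exists (Ordinal lt_e) => //.
by apply: (@chain_exp_inj n.+1 _ _ _ (residue r)); rewrite ?fE //;
  [exact: residue_lt | exact: residue_inj].
Qed.

End ChainLength.

Section ChainSums.
Variables (F : fieldType) (q : F).
Hypotheses (q_neq0 : q != 0) (q_nroot : forall a, (0 < a)%N -> q ^+ a != 1).
Variable n : nat.

Lemma hlQ_chain (m k r N : nat) : (0 < m)%N ->
  (forall i : 'I_n.+1, (r < chain_len N r i)%N) ->
  let c := residue r in let p := n.+1 in
  hlQ (fun i : 'I_N => q ^+ i) (q ^+ n.+1) (rect_part m r k) =
  qpoch (q ^+ n.+1) (q ^+ n.+1) r *
    (if k == 0%N then (1 - (q ^+ n.+1) ^+ (N - r))^-1 else 1) *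
  \sum_(rho : {ffun 'I_n.+1 -> 'I_r.+1} | (\sum_i rho i == r)%N)
    chain_prod q p c (fun i => rho i) (chain_len N r) /
      chain_prod q p c (fun i => rho i) (fun i => rho i) *
    (q ^+ (m * chain_weight p c (fun i => rho i)) *
     \sum_(i < n.+1) (q ^+ (c i + p * rho i)) ^+ k *
       ((\prod_j gap q (c i + p * rho i) (c j + p * chain_len N r j)) /
        \prod_(j | j != i) gap q (c i + p * rho i) (c j + p * rho j))).
Proof.
move=> m_gt0 r_lt c p.
have [f fE f_im] := ex_chain_index n N r.
have c_lt i : (c i < p)%N := residue_lt r i.
have c_inj : injective c := @residue_inj n r.
have p_gt0 : (0 < p)%N by [].
have len_le (i : 'I_n.+1) := chain_len_le N r i.
pose x (b : 'I_n.+1 * 'I_N) := q ^+ chain_exp p c b.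
have x_inj : injective x.
  by move=> b b' /(expr_inj q_neq0 q_nroot); exact: chain_exp_inj.
have x_neq0 b : x b != 0 by rewrite expf_neq0.
have f_inj : injective f by move=> a b eq_f; apply: val_inj; rewrite /= -(fE a) eq_f fE.
have lt_rN : (r < N)%N := leq_trans (r_lt ord0) (len_le ord0).
have -> : (fun i : 'I_N => q ^+ i) = (fun i => x (f i)).
  by apply: funext => i; rewrite /x fE.
rewrite (hlQ_rect (q_expn_nroot q_nroot p_gt0) x_inj x_neq0) // f_im.
congr (_ * _).
rewrite (sum_hl_cross_chain q_neq0 q_nroot p_gt0 c len_le
  (fun J => (\prod_(a in J) x a ^+ m) * ((1 - q ^+ p) *
      \sum_(a in chain_set N (chain_len N r) :\: J) x a ^+ k *
       \prod_(b in chain_set N (chain_len N r) :\: J :\ a) hl_ratio (q ^+ p) (x a) (x b)))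
  (fun i => ltnW (r_lt i))).
apply: eq_bigr => rho _.
have rho_lt i : (rho i < chain_len N r i)%N by apply: leq_ltn_trans (r_lt i); rewrite -ltnS.
rewrite hl_cross_chain //; last by move=> i; exact: ltnW.
congr (_ * (_ * _)); last exact: sum_chain_next.
rewrite big_chain_set mulnC exprM /chain_weight -prodrXr -prodrXl; apply: eq_bigr => i _ /=.
rewrite -prodrXr -prodrXl (big_ord_widen N (fun l => (q ^+ (c i + p * l)) ^+ m)) //.
exact: leq_trans (ltnW (rho_lt i)) (len_le i).
Qed.

(** Chains of equal length and no exponents: the surviving sets give the left side, while
    [sum_hl_cross] evaluates the sum over all sets. *)
Lemma sum_chain_prod (p r L : nat) (c : 'I_n.+1 -> nat) :
  (0 < p)%N -> (forall i, (c i < p)%N) -> injective c -> (r <= L)%N ->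
  \sum_(rho : {ffun 'I_n.+1 -> 'I_r.+1} | (\sum_i rho i == r)%N)
    chain_prod q p c (fun i => rho i) (fun=> L) /
      chain_prod q p c (fun i => rho i) (fun i => rho i) =
  qpoch (q ^+ p) (q ^+ p) (n.+1 * L) /
   (qpoch (q ^+ p) (q ^+ p) r * qpoch (q ^+ p) (q ^+ p) (n.+1 * L - r)).
Proof.
move=> p_gt0 c_lt c_inj le_rL.
pose x (b : 'I_n.+1 * 'I_L) := q ^+ chain_exp p c b.
have x_inj : injective x.
  by move=> b b' /(expr_inj q_neq0 q_nroot); exact: chain_exp_inj.
have x_neq0 b : x b != 0 by rewrite expf_neq0.
have card_S : #|@chain_set n.+1 L (fun=> L)| = (n.+1 * L)%N.
  by rewrite card_chain_set // sum_nat_const card_ord.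
rewrite -card_S -(sum_hl_cross (q_expn_nroot q_nroot p_gt0) x_inj x_neq0); last first.
  by rewrite card_S mulSn (leq_trans le_rL) ?leq_addr.
have := @sum_hl_cross_chain _ _ q_neq0 q_nroot p p_gt0 _ L c (fun=> L) (fun=> leqnn L) r
  (fun=> 1) (fun=> le_rL).
under eq_bigr => J _ do rewrite mulr1.
move=> ->; apply: eq_bigr => rho _; rewrite mulr1 hl_cross_chain // => i.
by rewrite (leq_trans _ le_rL) // -ltnS.
Qed.

End ChainSums.

(** * Limits of power series *)

Lemma val_inord (r k : nat) : (inord k : 'I_r.+1) = (if (k <= r)%N then k else 0%N) :> nat.
Proof. by rewrite /inord val_insubd ltnS. Qed.

Lemma ex_uniform_bound (I : finType) (P : I -> nat -> Prop) :
  (forall i, exists k0, forall k, (k0 <= k)%N -> P i k) ->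
  exists k0, forall k, (k0 <= k)%N -> forall i, P i k.
Proof.
move=> /fin_all_exists[k0 Pk0]; exists (\max_i k0 i) => k le_k i.
by apply: Pk0; apply: leq_trans le_k; exact: leq_bigmax.
Qed.

Section Valuation.
(* The field of fractions of [fps R] is kept abstract: unification would otherwise
   unfold its construction. *)
Variable R : fieldType.
Variables (K : fieldType) (iota : {rmorphism fps R -> K}) (q : K).
Hypotheses (iota_inj : injective iota) (iotaX : iota (fps_X R) = q).
Let X := fps_X R.
Let iotaXn (k : nat) : iota (X ^+ k) = q ^+ k.
Proof. by rewrite rmorphXn /= iotaX. Qed.

Lemma fps_coefXM (p : fps R) (d : nat) :
  fps_coef (X * p) d = if d is d'.+1 then fps_coef p d' else 0.
Proof.
rewrite fps_coefM big_ord_recl /= mul0r add0r; case: d => [|d]; first by rewrite big_ord0.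
rewrite big_ord_recl /= mul1r subSS subn0 big1 ?addr0 // => i _.
by rewrite mul0r.
Qed.

Lemma fps_coefXnM (p : fps R) (k d : nat) :
  fps_coef (X ^+ k * p) d = if (d < k)%N then 0 else fps_coef p (d - k).
Proof.
elim: k d => [|k IHk] d; first by rewrite mul1r subn0.
by rewrite exprS -mulrA fps_coefXM; case: d => [|d] //; rewrite IHk.
Qed.

Lemma fps_factorXn (p : fps R) (k : nat) :
  (forall d, (d < k)%N -> fps_coef p d = 0) -> exists p', p = X ^+ k * p'.
Proof.
move=> p0; exists (FPS (fun d => fps_coef p (d + k))); apply: fpsP => d.
by rewrite fps_coefXnM; case: ltnP => [/p0//|le_kd] /=; rewrite subnK.
Qed.

Let iota_eq0 (p : fps R) : (iota p == 0) = (p == 0).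
Proof. by rewrite -[X in _ == X](rmorph0 iota) (inj_eq iota_inj). Qed.

Lemma iota_X_neq0 : q != 0.
Proof.
rewrite -iotaX iota_eq0; apply/eqP => /(congr1 (fun p => fps_coef p 1)) /eqP.
by rewrite /= oner_eq0.
Qed.
Hint Resolve iota_X_neq0 : core.

(* [x] is a Laurent series without terms of degree less than [d]. *)
Definition vge (d : int) (x : K) : Prop := exists p : fps R, x = q ^ d * (iota p).

Lemma vge_expz (d : int) : vge d (q ^ d).
Proof. by exists 1; rewrite rmorph1 mulr1. Qed.

Lemma vge_iota (p : fps R) : vge 0 (iota p).
Proof. by exists p; rewrite expr0z mul1r. Qed.

Lemma vge0 (d : int) : vge d 0.
Proof. by exists 0; rewrite rmorph0 mulr0. Qed.

Lemma vge1 : vge 0 1.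
Proof. by rewrite -(rmorph1 iota); exact: vge_iota. Qed.

Lemma vgeD (d : int) (x y : K) : vge d x -> vge d y -> vge d (x + y).
Proof. by move=> [p ->] [p' ->]; exists (p + p'); rewrite rmorphD mulrDr. Qed.

Lemma vgeN (d : int) (x : K) : vge d x -> vge d (- x).
Proof. by move=> [p ->]; exists (- p); rewrite rmorphN mulrN. Qed.

Lemma vgeB (d : int) (x y : K) : vge d x -> vge d y -> vge d (x - y).
Proof. by move=> vx /vgeN; exact: vgeD. Qed.

Lemma vgeM (d d' : int) (x y : K) : vge d x -> vge d' y -> vge (d + d') (x * y).
Proof.
move=> [p ->] [p' ->]; exists (p * p').
by rewrite rmorphM expfzDr // mulrACA.
Qed.

Lemma vgeMl (d : int) (x y : K) : vge 0 x -> vge d y -> vge d (x * y).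
Proof. by move=> vx vy; rewrite -[d]add0r; exact: vgeM. Qed.

Lemma vgeMr (d : int) (x y : K) : vge d x -> vge 0 y -> vge d (x * y).
Proof. by move=> vx vy; rewrite -[d]addr0; exact: vgeM. Qed.

Lemma vge_le (d d' : int) (x : K) : (d' <= d)%R -> vge d x -> vge d' x.
Proof.
move=> le_d [p ->]; have [k ->] : exists k : nat, d = d' + k%:Z.
  by exists `|d - d'|%N; lia.
exists (X ^+ k * p); rewrite rmorphM iotaXn expfzDr // mulrA.
by rewrite -exprnP.
Qed.

Lemma vge_sum (d : int) (I : Type) (r : seq I) (P : pred I) (f : I -> K) :
  (forall i, P i -> vge d (f i)) -> vge d (\sum_(i <- r | P i) f i).
Proof.
by move=> vf; apply: (big_ind (vge d)); [exact: vge0 | exact: vgeD | exact: vf].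
Qed.

Lemma vge_prod (I : Type) (r : seq I) (P : pred I) (f : I -> K) :
  (forall i, P i -> vge 0 (f i)) -> vge 0 (\prod_(i <- r | P i) f i).
Proof.
by move=> vf; apply: (big_ind (vge 0)); [exact: vge1 | exact: vgeMl | exact: vf].
Qed.

Lemma vgeX (k : nat) (x : K) : vge 0 x -> vge 0 (x ^+ k).
Proof. by move=> vx; rewrite -[k]card_ord -prodr_const; apply: vge_prod. Qed.

Lemma vge_expn (k : nat) : vge 0 (q ^+ k).
Proof. by rewrite -iotaXn; exact: vge_iota. Qed.

Definition vunit (x : K) : Prop := [/\ x != 0, vge 0 x & vge 0 x^-1].

Lemma vunit1 : vunit 1.
Proof. by split; rewrite ?invr1 ?oner_eq0 //; exact: vge1. Qed.

Lemma vunitM (x y : K) : vunit x -> vunit y -> vunit (x * y).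
Proof.
move=> [x0 vx vix] [y0 vy viy]; split; rewrite ?mulf_neq0 ?invfM //; exact: vgeMl.
Qed.

Lemma vunitV (x : K) : vunit x -> vunit x^-1.
Proof. by move=> [x0 vx vix]; split; rewrite ?invrK ?invr_eq0. Qed.

Lemma vunit_prod (I : Type) (r : seq I) (P : pred I) (f : I -> K) :
  (forall i, P i -> vunit (f i)) -> vunit (\prod_(i <- r | P i) f i).
Proof.
by move=> vf; apply: (big_ind vunit); [exact: vunit1 | exact: vunitM | exact: vf].
Qed.

Lemma vunitX (k : nat) (x : K) : vunit x -> vunit (x ^+ k).
Proof. by move=> vx; rewrite -[k]card_ord -prodr_const; apply: vunit_prod. Qed.

Lemma vunit_iota (p : fps R) : fps_coef p 0 != 0 -> vunit (iota p).
Proof.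
move=> p0; have up : p \is a GRing.unit by [].
have pV : ((iota p))^-1 = (iota (p^-1)).
  by apply: (mulfI (_ : (iota p) != 0)); rewrite ?divff -?rmorphM ?mulrV ?rmorph1 // iota_eq0;
    apply: contraNneq p0 => ->.
split; rewrite ?pV; try exact: vge_iota.
by rewrite iota_eq0; apply: contraNneq p0 => ->.
Qed.

Lemma vunit_1subXn (a : nat) : (0 < a)%N -> vunit (1 - q ^+ a).
Proof.
move=> a_gt0; rewrite -iotaXn -(rmorph1 iota) -rmorphB; apply: vunit_iota.
by rewrite fps_coefB -[X ^+ a]mulr1 fps_coefXnM a_gt0 subr0 oner_eq0.
Qed.

Lemma iota_X_nroot (a : nat) : (0 < a)%N -> q ^+ a != 1.
Proof. by move=> /vunit_1subXn[]; rewrite subr_eq0 eq_sym. Qed.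

(** For [b < a] the gap has negative exponents, but its inverse is [- q^(a-b) / (1 - q^(a-b))]. *)
Lemma vge_gap_inv (a b : nat) : a != b -> vge 0 (gap q a b)^-1.
Proof.
case: ltngtP => // [lt_ab|lt_ba] _.
  have -> : gap q a b = 1 - q ^+ (b - a).
    by rewrite gapE // -{1}(subnKC (ltnW lt_ab)) exprD mulrBl divff ?expf_neq0 // mulrAC divff
      ?expf_neq0 // mul1r.
  by have [] // : vunit (1 - q ^+ (b - a)); apply: vunit_1subXn; rewrite subn_gt0.
have [u0 vu vuV] : vunit (1 - q ^+ (a - b)) by apply: vunit_1subXn; rewrite subn_gt0.
have -> : (gap q a b)^-1 = - q ^+ (a - b) * (1 - q ^+ (a - b))^-1.
  have qb : q ^+ b != 0 by rewrite expf_neq0.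
  have qc : q ^+ (a - b) != 0 by rewrite expf_neq0.
  have -> : gap q a b = (q ^+ (a - b) - 1) / q ^+ (a - b).
    rewrite gapE // -{1 2}(subnKC (ltnW lt_ba)) exprD; field; exact/andP.
  by field; rewrite qc u0 -opprB oppr_eq0 u0.
by apply: vgeMl => //; apply/vgeN/vge_expn.
Qed.

Lemma vunit_qpoch (a p k : nat) : (0 < a)%N -> vunit (qpoch (q ^+ a) (q ^+ p) k).
Proof.
move=> a_gt0; apply: vunit_prod => j _; rewrite -exprM -exprD; apply: vunit_1subXn.
by rewrite addn_gt0 a_gt0.
Qed.

(** Congruence modulo q^d among Laurent series. Products need factors without negative exponents,
    see [veqM]. *)
Definition veq (d : int) (x y : K) : Prop := vge d (x - y).

Lemma veq_refl (d : int) (x : K) : veq d x x.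
Proof. by rewrite /veq subrr; exact: vge0. Qed.

Lemma veq_sym (d : int) (x y : K) : veq d x y -> veq d y x.
Proof. by move/vgeN; rewrite opprB. Qed.

Lemma veq_trans (d : int) (y x z : K) : veq d x y -> veq d y z -> veq d x z.
Proof. by move=> xy /(vgeD xy); rewrite addrA subrK. Qed.

Lemma veqM (d : int) (x x' y y' : K) : vge 0 y -> vge 0 x' ->
  veq d x x' -> veq d y y' -> veq d (x * y) (x' * y').
Proof.
move=> vy vx' /vgeMr/(_ vy) xx' /(vgeMl vx') yy'; rewrite /veq.
have -> : x * y - x' * y' = (x - x') * y + x' * (y - y') by ring.
exact: vgeD.
Qed.

Lemma veq_prod (d : int) (I : Type) (r : seq I) (P : pred I) (f g : I -> K) :
  (forall i, P i -> vge 0 (f i)) -> (forall i, P i -> vge 0 (g i)) ->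
  (forall i, P i -> veq d (f i) (g i)) ->
  veq d (\prod_(i <- r | P i) f i) (\prod_(i <- r | P i) g i).
Proof.
move=> vf vg fg.
have [] // : [/\ vge 0 (\prod_(i <- r | P i) f i), vge 0 (\prod_(i <- r | P i) g i) &
   veq d (\prod_(i <- r | P i) f i) (\prod_(i <- r | P i) g i)].
apply: (big_ind2 (fun x y => [/\ vge 0 x, vge 0 y & veq d x y])).
- by split; [exact: vge1 | exact: vge1 | exact: veq_refl].
- move=> x1 x2 y1 y2 [vx1 vx2 x12] [vy1 vy2 y12].
  by split; [exact: vgeMl | exact: vgeMl | exact: veqM].
- by move=> i Pi; split; [exact: vf | exact: vg | exact: fg].
Qed.

Lemma veqV (d : int) (x y : K) : vunit x -> vunit y -> veq d x y -> veq d x^-1 y^-1.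
Proof.
move=> [x0 _ vx] [y0 _ vy] xy; rewrite /veq.
have -> : x^-1 - y^-1 = - (x^-1 * y^-1 * (x - y)) by field; rewrite x0 y0.
by apply/vgeN/vgeMl => //; exact: vgeMl.
Qed.

Lemma fps_cvg_vge (u : nat -> fps R) (l : fps R) :
  (forall d : nat, exists N0, forall N, (N0 <= N)%N -> veq d%:Z (iota (u N)) (iota l)) ->
  fps_cvg u l.
Proof.
(* Precision [d.+1] is what fixes the coefficient of degree [d]. *)
move=> ul d; have [N0 uN0] := ul d.+1; exists N0 => N /uN0[p].
rewrite -rmorphB -exprnP -iotaXn -rmorphM => /eqP; rewrite (inj_eq iota_inj) => /eqP eq_p.
apply/eqP; rewrite -subr_eq0 -fps_coefB eq_p fps_coefXnM ltnSn.
by [].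
Qed.

Lemma vge_fps_cvg (u : nat -> fps R) (l : fps R) : fps_cvg u l ->
  forall d : nat, exists N0, forall N, (N0 <= N)%N -> veq d%:Z (iota (u N)) (iota l).
Proof.
move=> ul d; have [N0 uN0] : exists N0, forall N, (N0 <= N)%N -> forall i, (i < d)%N ->
    fps_coef (u N) i = fps_coef l i.
  elim: d => [|d [N0 uN0]]; first by exists 0%N.
  have [N1 uN1] := ul d; exists (maxn N0 N1) => N; rewrite geq_max => /andP[leN0 leN1] i.
  by rewrite ltnS leq_eqVlt => /predU1P[->|]; [exact: uN1 | exact: uN0].
exists N0 => N /uN0 eq_i; have [i lt_id|p eq_p] := @fps_factorXn (u N - l) d.
  by rewrite fps_coefB eq_i ?subrr.
by exists p; rewrite -rmorphB eq_p rmorphM iotaXn.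
Qed.

Lemma iota_qpoch (a p k : nat) :
  iota (qpoch (X ^+ a) (X ^+ p) k) = qpoch (q ^+ a) (q ^+ p) k.
Proof.
rewrite /qpoch rmorph_prod; apply: eq_bigr => j _ /=.
by rewrite rmorphB rmorph1 rmorphM !rmorphXn /= iotaX.
Qed.

Lemma veq_qpoch_inf (a p : nat) : (0 < p)%N -> forall d : nat, exists k0, forall k,
  (k0 <= k)%N -> veq d%:Z (qpoch (q ^+ a) (q ^+ p) k) (iota (qpoch_inf (X ^+ a) (X ^+ p))).
Proof.
move=> p_gt0 d; have X0 : fps_coef (X ^+ p) 0 = 0.
  by rewrite -[X ^+ p]mulr1 fps_coefXnM p_gt0.
have [k0 qk0] := vge_fps_cvg (qpoch_inf_cvg (X ^+ a) X0) d.
by exists k0 => k /qk0; rewrite iota_qpoch.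
Qed.

Lemma vunit_qpoch_inf (a p : nat) : (0 < a)%N ->
  vunit (iota (qpoch_inf (X ^+ a) (X ^+ p))).
Proof.
move=> a_gt0; apply: vunit_iota; rewrite /= qpochS /qpoch big_ord0 mul1r mulr1.
by rewrite fps_coefB -[X ^+ a]mulr1 fps_coefXnM a_gt0 subr0 oner_eq0.
Qed.

Lemma veq_sum (d : int) (I : Type) (r : seq I) (P : pred I) (f g : I -> K) :
  (forall i, P i -> veq d (f i) (g i)) ->
  veq d (\sum_(i <- r | P i) f i) (\sum_(i <- r | P i) g i).
Proof. by move=> fg; rewrite /veq -sumrB; apply: vge_sum. Qed.

Lemma vge_sign (k : nat) : vge 0 ((-1) ^+ k).
Proof. by apply/vgeX/vgeN/vge1. Qed.

(** * Truncation of the lattice sum to a box *)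

Variable n : nat.

Lemma eq_lattice_term (N : nat) (u v : 'S_n.+1 -> 'I_n.+1 -> nat) (s s' : 'I_n.+1 -> int) :
  s =1 s' -> lattice_term q N u v s = lattice_term q N u v s'.
Proof.
move=> eq_s; apply: eq_bigr => w _; congr (_ * q ^ (_ * _ + _)).
  by apply: eq_bigr => i _; rewrite eq_s.
by apply: eq_bigr => i _; rewrite eq_s.
Qed.

Definition chain_den_inf (p : nat) (delta : 'I_n.+1 -> 'I_n.+1 -> nat) : K :=
  (\prod_(i < n.+1) iota (qpoch_inf (X ^+ p) (X ^+ p))) *
  \prod_(i < n.+1) \prod_(j < n.+1 | (i < j)%N)
    (iota (qpoch_inf (X ^+ delta i j) (X ^+ p)) *
     iota (qpoch_inf (X ^+ (p - delta i j)) (X ^+ p))).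

Section ChainLimit.
Variables (p N : nat) (delta : 'I_n.+1 -> 'I_n.+1 -> nat).
Variables (u v : 'S_n.+1 -> 'I_n.+1 -> nat).
Hypotheses (p_gt0 : (0 < p)%N) (N_gt0 : (0 < N)%N).
Hypothesis delta_lt : forall i j : 'I_n.+1, (i < j)%N -> (0 < delta i j < p)%N.

Let Vt := lattice_term q N u v.

Lemma vunit_chain_den_inf : vunit (chain_den_inf p delta).
Proof.
apply: vunitM; first by apply: vunit_prod => i _; exact: vunit_qpoch_inf.
apply: vunit_prod => i _; apply: vunit_prod => j /delta_lt/andP[d_gt0 d_lt].
by apply: vunitM; apply: vunit_qpoch_inf; rewrite ?subn_gt0.
Qed.

Lemma chain_sum_limit (d : nat) : exists D0, forall D, (D0 <= D)%N ->
  exists H0, forall (c h : 'I_n.+1 -> nat) (r : nat),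
    (forall i, (c i < p)%N) ->
    (forall i j : 'I_n.+1, (i < j)%N -> c j + p * h j = c i + p * h i + delta i j)%N ->
    (\sum_i h i = r)%N -> (forall i, (H0 <= h i)%N) ->
  veq d%:Z
    (\sum_(rho : {ffun 'I_n.+1 -> 'I_r.+1} | (\sum_i rho i == r)%N)
       Vt (fun i => (rho i)%:Z - (h i)%:Z) / chain_den q p c h (fun i => rho i))
    (box_sum D Vt / chain_den_inf p delta).
Proof.
pose U := (\sum_w \sum_i u w i)%N.
have le_u w i : (u w i <= U)%N.
  by rewrite /U (bigD1 w) //= (bigD1 i) //= -addnA leq_addr.
(* Exponents in a lattice term are at least [- C], so the denominators are approximated with
   precision [d + C]. *)
pose C := (n.+1 * U ^ 2)%N.
have vgeV s : vge (- C%:Z) (Vt s).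
  apply: vge_sum => w _; apply: vgeMl; first exact: vge_sign.
  by apply: (vge_le _ (vge_expz _)); exact: quad_sum_lower.
have [D0 large_D0] := @quad_sum_large n.+1 N U d N_gt0.
have vgeV_large D s : (D0 <= D)%N -> (exists i, D%:Z < s i \/ s i < - D%:Z) -> vge d%:Z (Vt s).
  move=> le_D s_out; apply: vge_sum => w _; apply: vgeMl; first exact: vge_sign.
  by apply: (vge_le _ (vge_expz _)); exact: (large_D0 D).
exists D0 => D le_D.
have [k1 q_k1] := veq_qpoch_inf p p_gt0 (d + C).
have [k2 q_k2] := ex_uniform_bound (fun i => ex_uniform_bound (fun j =>
  veq_qpoch_inf (delta i j) p_gt0 (d + C))).
have [k3 q_k3] := ex_uniform_bound (fun i => ex_uniform_bound (fun j =>
  veq_qpoch_inf (p - delta i j) p_gt0 (d + C))).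
(* This leaves the Pochhammer symbols long enough after a deviation of [D], and [h i > D] keeps
   [h i + sg i - D] from truncation. *)
exists (k1 + k2 + k3 + D + 1)%N => c h r c_lt hE sum_h h_ge.
have h_gt i : (D < h i)%N by have := h_ge i; lia.
have deltaE (i j : 'I_n.+1) : (i < j)%N -> (c j + p * h j - (c i + p * h i) = delta i j)%N.
  by move=> /hE ->; rewrite addKn.
have unit_pair (i j : 'I_n.+1) a b : (i < j)%N ->
    vunit (qpoch (q ^+ delta i j) (q ^+ p) a * qpoch (q ^+ (p - delta i j)) (q ^+ p) b).
  move=> /delta_lt/andP[d_gt0 d_lt].
  by apply: vunitM; apply: vunit_qpoch; rewrite ?subn_gt0.
have unit_den rho : vunit (chain_den q p c h rho).
  apply: vunitM; first by apply: vunit_prod => i _; exact: vunit_qpoch.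
  apply: vunit_prod => i _; apply: vunit_prod => j lt_ij; rewrite deltaE //.
  exact: unit_pair.
pose inbox (rho : {ffun 'I_n.+1 -> 'I_r.+1}) :=
  [forall i, (h i <= rho i + D)%N && (rho i <= h i + D)%N].
rewrite (bigID inbox) /=; set A := \sum_(_ | _ && inbox _) _; set B := \sum_(_ | _) _.
have vB : vge d%:Z B.
  apply: vge_sum => rho /andP[_ /forallPn[i out_i]]; apply: vgeMr; last first.
    by case: (unit_den (fun i => rho i)).
  apply: (vgeV_large D) => //; exists i; move: out_i; rewrite negb_and -!ltnNge; lia.
(* Inverse shifts between box points and length vectors. The default 0 of [inord] is excluded by the
   total [r] or by the box condition. *)
pose phi (sg : {ffun 'I_n.+1 -> 'I_(D.*2.+1)}) : {ffun 'I_n.+1 -> 'I_r.+1} :=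
  [ffun i => inord (h i + sg i - D)].
pose psi (rho : {ffun 'I_n.+1 -> 'I_r.+1}) : {ffun 'I_n.+1 -> 'I_(D.*2.+1)} :=
  [ffun i => inord (rho i + D - h i)].
have sum_phi (sg : {ffun 'I_n.+1 -> 'I_(D.*2.+1)}) :
    reflect (\sum_i (h i + sg i - D) = r)%N (\sum_i ((sg i)%:Z - D%:Z) == 0).
  have eq_sum : (\sum_i (h i + sg i - D) + \sum_(i < n.+1) D = r + \sum_i sg i)%N.
    rewrite -big_split -sum_h -big_split /=; apply: eq_bigr => i _.
    by rewrite subnK // (leq_trans (ltnW (h_gt i))) ?leq_addr.
  rewrite sumrB -!(big_morph Posz PoszD erefl) subr_eq0 eqz_nat.
  apply: (iffP eqP) => [eqD|eqr]; apply/eqP.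
    by rewrite -(eqn_add2r (\sum_(i < n.+1) D)) eq_sum eqD.
  by rewrite -(eqn_add2l r) -eq_sum eqr.
have phi_val (sg : {ffun 'I_n.+1 -> 'I_(D.*2.+1)}) : \sum_i ((sg i)%:Z - D%:Z) == 0 ->
    forall i, phi sg i = (h i + sg i - D)%N :> nat.
  move=> sum_sg i; rewrite ffunE val_inord ifT //.
  have sum_r : (\sum_i (h i + sg i - D) = r)%N by exact/sum_phi.
  by rewrite -sum_r (bigD1 i) //= leq_addr.
have -> : A = \sum_(sg : {ffun 'I_n.+1 -> 'I_(D.*2.+1)} | \sum_i ((sg i)%:Z - D%:Z) == 0)
    Vt (fun i => (sg i)%:Z - D%:Z) / chain_den q p c h (fun i => phi sg i).
  rewrite /A (reindex_onto phi psi) /=; last first.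
    move=> rho /andP[_ /forallP in_rho]; apply/ffunP => i; apply: val_inj.
    have /andP[le1 le2] := in_rho i; rewrite ffunE /= val_inord ffunE val_inord.
    have := ltn_ord (rho i); case: ifP; case: ifP; lia.
  rewrite (eq_bigl (fun sg : {ffun 'I_n.+1 -> 'I_(D.*2.+1)} =>
    \sum_i ((sg i)%:Z - D%:Z) == 0)); last first.
    move=> sg; apply/idP/idP.
      move=> /andP[/andP[/eqP sum_r /forallP in_sg] _]; apply/sum_phi.
      rewrite -[RHS]sum_r; apply: eq_bigr => i _.
      have /andP[le1 _] := in_sg i; move: le1; rewrite ffunE val_inord.
      by have := h_gt i; case: ifP => //; lia.
    move=> sum_sg; apply/andP; split; [apply/andP; split|].
    - by apply/eqP; rewrite -[RHS](elimT (sum_phi sg) sum_sg); apply: eq_bigr => i _; exact: phi_val.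
    - by apply/forallP => i; rewrite phi_val //; have := h_gt i; have := ltn_ord (sg i); lia.
    apply/eqP/ffunP => i; apply: val_inj; rewrite ffunE /= val_inord phi_val //.
    by have := h_gt i; have := ltn_ord (sg i); case: ifP; lia.
  apply: eq_bigr => sg sum_sg; congr (_ / _); apply: eq_lattice_term => i.
  by rewrite phi_val //; have := h_gt i; lia.
have -> : box_sum D Vt / chain_den_inf p delta =
  \sum_(sg : {ffun 'I_n.+1 -> 'I_(D.*2.+1)} | \sum_i ((sg i)%:Z - D%:Z) == 0)
    Vt (fun i => (sg i)%:Z - D%:Z) / chain_den_inf p delta by rewrite mulr_suml.
rewrite -[X in veq _ _ X]addr0; rewrite /veq opprD addrACA subr0; apply: vgeD => //.
apply: veq_sum => sg sum_sg; rewrite /veq -mulrBr.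
rewrite (_ : d%:Z = - C%:Z + (d + C)%N%:Z); last by rewrite PoszD addrC addrK.
apply: vgeM => //.
have phi_ge i : (k1 + k2 + k3 <= phi sg i)%N by rewrite phi_val //; have := h_ge i; lia.
apply: (veqV (unit_den _) vunit_chain_den_inf).
have unitV x : vunit x -> vge 0 x by case.
have hij (i j : 'I_n.+1) : (i < j)%N -> (h i <= h j <= (h i).+1)%N.
  move=> lt_ij; have := hE _ _ lt_ij; have /andP[d_gt0 d_lt] := delta_lt lt_ij.
  have := c_lt i; have := c_lt j; nia.
apply: veqM.
- apply: vge_prod => i _; apply: vge_prod => j lt_ij; rewrite deltaE //.
  exact/unitV/unit_pair.
- by apply: vge_prod => i _; exact: vge_iota.
- apply: veq_prod => i _; [by apply/unitV/vunit_qpoch | exact: vge_iota | apply: q_k1].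
  by have := phi_ge i; lia.
- apply: veq_prod => i _.
  + by apply: vge_prod => j lt_ij; rewrite deltaE //; exact/unitV/unit_pair.
  + by apply: vge_prod => j _; apply: vgeMl; exact: vge_iota.
  apply: veq_prod => j lt_ij.
  + by rewrite deltaE //; exact/unitV/unit_pair.
  + by apply: vgeMl; exact: vge_iota.
  have /andP[d_gt0 d_lt] := delta_lt lt_ij; have hh := hij _ _ lt_ij.
  rewrite deltaE //; apply: veqM.
  + by apply/unitV/vunit_qpoch; rewrite subn_gt0.
  + exact: vge_iota.
  + by apply: q_k2; have := phi_ge j; lia.
  + by apply: q_k3; have := phi_ge i; lia.
Qed.
End ChainLimit.

(** * Hall-Littlewood functions in infinitely many variables *)

Lemma vge_gap (a b : nat) : (a <= b)%N -> vge 0 (gap q a b).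
Proof.
move=> le_ab; rewrite /gap subzn //; apply: vgeB; [exact: vge1 | exact: vge_expn].
Qed.

Lemma veq_gap1 (d a b : nat) : (a + d <= b)%N -> veq d%:Z (gap q a b) 1.
Proof.
move=> le_ab; rewrite /veq /gap addrAC subrr sub0r; apply: vgeN.
by apply: (vge_le _ (vge_expz _)); lia.
Qed.

Lemma vge_chain_prod_inv (p : nat) (c rho : 'I_n.+1 -> nat) :
  (0 < p)%N -> (forall i, (c i < p)%N) -> injective c ->
  vge 0 (chain_prod q p c rho rho)^-1.
Proof.
move=> p_gt0 c_lt c_inj; rewrite /chain_prod -prodfV; apply: vge_prod => i _.
rewrite -prodfV; apply: vge_prod => l _; rewrite -prodfV; apply: vge_prod => j _.
apply: vge_gap_inv.
exact: (chain_end_neq p_gt0 c_lt c_inj (ltn_ord l) (leqnn _)).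
Qed.

Lemma vge_prod_gap_inv (p : nat) (c rho : 'I_n.+1 -> nat) (i : 'I_n.+1) :
  (forall i, (c i < p)%N) -> injective c ->
  vge 0 (\prod_(j | j != i) gap q (c i + p * rho i) (c j + p * rho j))^-1.
Proof.
move=> c_lt c_inj; rewrite -prodfV; apply: vge_prod => j ne_ji; apply: vge_gap_inv.
by rewrite (inj_eq (chain_end_inj c_lt c_inj (rho := rho))) eq_sym.
Qed.

(** The formula of [hlQ_chain] with the chain ends moved to infinity: the gaps to the ends and the
    correction for [k = 0] become 1. *)
Definition hlQ_inf (m k r : nat) : K :=
  qpoch (q ^+ n.+1) (q ^+ n.+1) r *
  \sum_(rho : {ffun 'I_n.+1 -> 'I_r.+1} | (\sum_i rho i == r)%N)
    (chain_prod q n.+1 (residue r) (fun i => rho i) (fun i => rho i))^-1 *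
    (q ^+ (m * chain_weight n.+1 (residue r) (fun i => rho i)) *
     chain_next q n.+1 k (residue r) (fun i => rho i)).

(** Only the elements numbered 0 to [r] of a chain occur. For large [N] their exponents lie at least
    [d] below the chain ends, so those gaps are 1 modulo q^d, and all other factors are free of
    negative exponents. *)
Lemma hlQ_inf_limit (m k r d : nat) : (0 < m)%N ->
  exists N0, forall N, (N0 <= N)%N ->
    veq d%:Z (hlQ (fun i : 'I_N => q ^+ i) (q ^+ n.+1) (rect_part m r k)) (hlQ_inf m k r).
Proof.
move=> m_gt0; exists (n.+1 * (r + 2) + d)%N => N le_N.
have r_lt (i : 'I_n.+1) : (r < chain_len N r i)%N.
  by rewrite ltn_chain_len; have := residue_lt r i; nia.
have len_ge (i : 'I_n.+1) : (N <= residue r i + n.+1 * chain_len N r i)%N.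
  by rewrite leqNgt -ltn_chain_len ltnn.
have far (i j : 'I_n.+1) l : (l <= r)%N ->
    (residue r i + n.+1 * l + d <= residue r j + n.+1 * chain_len N r j)%N.
  by move=> le_l; apply: leq_trans (len_ge j); have := residue_lt r i; nia.
have near (i j : 'I_n.+1) l : (l <= r)%N ->
    (residue r i + n.+1 * l <= residue r j + n.+1 * chain_len N r j)%N.
  by move=> le_l; apply: leq_trans (far i j l le_l); exact: leq_addr.
rewrite (hlQ_chain iota_X_neq0 iota_X_nroot k m_gt0 r_lt) /hlQ_inf.
have t_unit j : (0 < j)%N -> vunit (1 - (q ^+ n.+1) ^+ j).
  by move=> j_gt0; rewrite -exprM; apply: vunit_1subXn; rewrite muln_gt0.
have lt_rN : (r < N)%N by nia.
have eq_kappa : veq d%:Z (if k == 0%N then (1 - (q ^+ n.+1) ^+ (N - r))^-1 else 1) 1.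
  case: eqP => _; last exact: veq_refl.
  rewrite -[X in veq _ _ X]invr1; apply: veqV; [by apply: t_unit; lia | exact: vunit1 |].
  rewrite /veq addrAC subrr sub0r -exprM exprnP; apply: vgeN.
  by apply: (vge_le _ (vge_expz _)); nia.
have vge_kappa : vge 0 (if k == 0%N then (1 - (q ^+ n.+1) ^+ (N - r))^-1 else 1).
  case: eqP => _; last exact: vge1.
  by have [] // := t_unit (N - r)%N; rewrite subn_gt0.
have vge_t : vge 0 (qpoch (q ^+ n.+1) (q ^+ n.+1) r) by have [] := vunit_qpoch n.+1 r (ltn0Sn n).
have c_lt (i : 'I_n.+1) := residue_lt r i.
have c_inj := @residue_inj n r.
have y_le (rho : {ffun 'I_n.+1 -> 'I_r.+1}) i : (rho i <= r)%N by rewrite -ltnS.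
have vge_next (rho : {ffun 'I_n.+1 -> 'I_r.+1}) :
    vge 0 (chain_next q n.+1 k (residue r) (fun i => rho i)).
  apply: vge_sum => i _; apply: vgeMl; last exact: vge_prod_gap_inv.
  by apply: vgeX; exact: vge_expn.
have vge_len (rho : {ffun 'I_n.+1 -> 'I_r.+1}) (i : 'I_n.+1) : vge 0
    ((\prod_(j < n.+1) gap q (residue r i + n.+1 * rho i) (residue r j + n.+1 * chain_len N r j)) /
     \prod_(j | j != i) gap q (residue r i + n.+1 * rho i) (residue r j + n.+1 * rho j)).
  apply: vgeMl; last exact: vge_prod_gap_inv.
  by apply: vge_prod => j _; apply: vge_gap; exact: near.
have vge_sum_len (rho : {ffun 'I_n.+1 -> 'I_r.+1}) : vge 0
    (\sum_(i < n.+1) (q ^+ (residue r i + n.+1 * rho i)) ^+ k *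
     ((\prod_(j < n.+1) gap q (residue r i + n.+1 * rho i) (residue r j + n.+1 * chain_len N r j)) /
      \prod_(j | j != i) gap q (residue r i + n.+1 * rho i) (residue r j + n.+1 * rho j))).
  by apply: vge_sum => i _; apply: vgeMl => //; apply: vgeX; exact: vge_expn.
rewrite -[X in veq _ _ (X * _)]mulr1; apply: veqM.
- apply: vge_sum => rho _; apply: vgeMl.
    apply: vgeMl; last exact: vge_chain_prod_inv.
    apply: vge_prod => i _; apply: vge_prod => l _; apply: vge_prod => j _.
    apply: vge_gap; apply: near; apply: leq_trans (y_le rho i); exact: ltnW.
  by apply: vgeMl; first exact: vge_expn.
- by rewrite mulr1.
- by apply: veqM => //; exact: veq_refl.
apply: veq_sum => rho _; apply: veqM.
- by apply: vgeMl; first exact: vge_expn.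
- exact: vge_chain_prod_inv.
- rewrite -[X in veq _ _ X]mul1r; apply: veqM.
  + exact: vge_chain_prod_inv.
  + exact: vge1.
  + rewrite -[X in veq _ _ X](_ : \prod_(i < n.+1) \prod_(l < rho i) \prod_(j < n.+1) 1 = 1);
      last by rewrite !(big1, big1_eq) // => *; rewrite !big1.
    apply: veq_prod => i _; [by apply: vge_prod => l _; apply: vge_prod => j _; apply: vge_gap;
       apply: near; apply: leq_trans (y_le rho i); exact: ltnW
     | by do 2 (apply: vge_prod => ? _); exact: vge1 |].
    apply: veq_prod => l _; [by apply: vge_prod => j _; apply: vge_gap;
       apply: near; apply: leq_trans (y_le rho i); exact: ltnW
     | by apply: vge_prod => ? _; exact: vge1 |].
    have le_l : (l <= r)%N by apply: leq_trans (y_le rho i); exact: ltnW.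
    apply: veq_prod => j _; [by apply: vge_gap; exact: near | exact: vge1 |].
    by apply: veq_gap1; exact: far.
  + exact: veq_refl.
apply: veqM; [exact: vge_sum_len | exact: vge_expn | exact: veq_refl |].
apply: veq_sum => i _; apply: veqM.
- exact: vge_len.
- by apply: vgeX; exact: vge_expn.
- exact: veq_refl.
rewrite -[X in veq _ _ X]mul1r; apply: veqM.
- exact: vge_prod_gap_inv.
- exact: vge1.
- rewrite -[X in veq _ _ X](_ : \prod_(j < n.+1) 1 = 1); last by rewrite big1.
  apply: veq_prod => j _; [by apply: vge_gap; exact: near | exact: vge1 |].
  by apply: veq_gap1; exact: far.
- exact: veq_refl.
Qed.

Lemma chain_weight_incr (p : nat) (c rho : 'I_n.+1 -> nat) (i : 'I_n.+1) :
  (chain_weight p c (fun j => rho j + (j == i)) = chain_weight p c rho + (c i + p * rho i))%N.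
Proof.
rewrite /chain_weight (bigD1 i) //= [in RHS](bigD1 i) //= eqxx addn1 big_ord_recr /= addnAC.
by congr (_ + _ + _)%N; apply: eq_bigr => j /negPf->; rewrite addn0.
Qed.

(* Writes [m W + k y] as [(m - k) W + k (W + y)], where [W] and [W + y] are sums of
   [r] and [r + 1] distinct naturals. *)
Lemma vge_hlQ_inf (m k r : nat) : (k <= m)%N ->
  vge (m * 'C(r, 2) + k * r)%N%:Z (hlQ_inf m k r).
Proof.
move=> le_km; have c_lt (i : 'I_n.+1) := residue_lt r i; have c_inj := @residue_inj n r.
apply: vgeMl; first by have [] := vunit_qpoch n.+1 r (ltn0Sn n).
apply: vge_sum => rho /eqP sum_rho; apply: vgeMl; first exact: vge_chain_prod_inv.
rewrite mulr_sumr; apply: vge_sum => i _; rewrite mulrA; apply: vgeMr.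
  rewrite -exprM -exprD exprnP; apply: (vge_le _ (vge_expz _)).
  have W1 := chain_weight_ge (fun i => rho i) (ltn0Sn n) c_lt c_inj.
  have W2 := chain_weight_ge (fun j => rho j + (j == i))%N (ltn0Sn n) c_lt c_inj.
  rewrite sum_rho in W1; rewrite chain_weight_incr big_split /= sum_rho in W2.
  rewrite (bigD1 i) //= eqxx big1 ?addn0 ?addn1 ?binS ?bin1 in W2; last by move=> j /negPf->.
  have [x ->] : exists x, m = (k + x)%N by exists (m - k)%N; rewrite subnKC.
  move: W1 W2; set W := chain_weight _ _ _; set y := (residue r i + _)%N; nia.
exact: vge_prod_gap_inv.
Qed.

Lemma vge_hl_ratio (p a b : nat) : a != b -> vge 0 (hl_ratio (q ^+ p) (q ^+ a) (q ^+ b)).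
Proof.
move=> ne_ab; have gap_inv := vge_gap_inv ne_ab; rewrite /hl_ratio.
case: ltngtP ne_ab gap_inv => // [lt_ab|lt_ba] _ _.
  have [u0 _ uV] : vunit (1 - q ^+ (b - a)) by apply: vunit_1subXn; rewrite subn_gt0.
  have -> : (q ^+ a - q ^+ p * q ^+ b) / (q ^+ a - q ^+ b) =
      (1 - q ^+ p * q ^+ (b - a)) * (1 - q ^+ (b - a))^-1.
    rewrite -(subnKC (ltnW lt_ab)) exprD addKn; have qa : q ^+ a != 0 by rewrite expf_neq0.
    by field; rewrite u0 -{1}[q ^+ a]mulr1 -mulrBr mulf_neq0.
  apply: vgeMl => //; apply: vgeB; first exact: vge1.
  by apply: vgeMl; exact: vge_expn.
have [u0 _ uV] : vunit (1 - q ^+ (a - b)) by apply: vunit_1subXn; rewrite subn_gt0.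
have -> : (q ^+ a - q ^+ p * q ^+ b) / (q ^+ a - q ^+ b) =
    (q ^+ p - q ^+ (a - b)) * (1 - q ^+ (a - b))^-1.
  rewrite -(subnKC (ltnW lt_ba)) exprD addKn; have qb : q ^+ b != 0 by rewrite expf_neq0.
  by field; rewrite u0 -{2}[q ^+ b]mulr1 -mulrBr mulf_neq0 // -opprB oppr_eq0.
by apply: vgeMl => //; apply: vgeB; exact: vge_expn.
Qed.

(** [is_hlQ_principal] asks for a power series at every [N], also where the chains are too short for
    [hlQ_chain]. Each ratio at distinct powers of [q] is a power series, so the sum over
    permutations suffices. *)
Lemma vge_hlQ (p N : nat) (la : seq nat) : (0 < p)%N -> all (fun i => 0 < i)%N la ->
  vge 0 (hlQ (fun i : 'I_N => q ^+ i) (q ^+ p) la).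
Proof.
move=> p_gt0 la_gt0; have [le_N|gt_N] := leqP (size la) N; last first.
  by rewrite /hlQ /hlP leqNgt gt_N mulr0; exact: vge0.
have t_nroot := q_expn_nroot iota_X_nroot p_gt0.
have [_ vt vtV] : vunit (1 - q ^+ p) by exact: vunit_1subXn.
rewrite hlQ_perm_sum //; apply: vgeMl.
  apply: vgeMl; first exact: vgeX.
  have /vunitV[] // : vunit (hl_qfact (q ^+ p) (N - size la)).
  by apply: vunitM; [exact: vunit_qpoch | apply/vunitV/vunitX/vunit_1subXn].
apply: vge_sum => w _; apply: vgeMl.
  by apply: vge_prod => i _; apply: vgeX; exact: vge_expn.
apply: vge_prod => i _; apply: vge_prod => j lt_ij; apply: vge_hl_ratio.
by rewrite (inj_eq val_inj) (inj_eq perm_inj) -val_eqE /= ltn_eqF.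
Qed.

(** * Limits of the two computations and their comparison *)

Lemma vge_lattice_const : vge (- (\sum_(i < n.+1) (n - i) * i)%N%:Z) (lattice_const q n).
Proof.
rewrite /lattice_const exprnP invr_expz; apply: vgeMl; last exact: vge_expz.
by apply: vge_prod => i _; apply: vge_prod => j _; apply/vgeN/vge1.
Qed.

Definition residue_lattice_term (m k : nat) : ('I_n.+1 -> int) -> K :=
  lattice_term q (n.+1 * (m + n.+1))
    (fun w i => (m + n.+1) * i + n.+1 * hook_exp k (w i))%N
    (fun w i => hook_exp k (w i) * i)%N.

Lemma hlQ_inf_box_limit (m k d : nat) : (k <= m)%N ->
  exists D0, forall D, (D0 <= D)%N -> exists r0, forall r, (r0 <= r)%N ->
  veq d%:Z (q ^- (m * 'C(r, 2) + k * r) * hlQ_inf m k r)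
    (iota (qpoch_inf (X ^+ n.+1) (X ^+ n.+1)) *
     (lattice_const q n * box_sum D (residue_lattice_term m k) /
      chain_den_inf n.+1 (fun i j => j - i)%N)).
Proof.
move=> le_km; set ex0 := (\sum_(i < n.+1) (n - i) * i)%N.
have delta_lt (i j : 'I_n.+1) : (i < j)%N -> (0 < j - i < n.+1)%N.
  by have := ltn_ord j; lia.
have N_gt0 : (0 < n.+1 * (m + n.+1))%N by rewrite addnS.
(* The extra precision [ex0] makes up for the negative power of [q] in [lattice_const]. *)
have [D0 limD] := chain_sum_limit (fun w i => (m + n.+1) * i + n.+1 * hook_exp k (w i))%N
  (fun w i => hook_exp k (w i) * i)%N (ltn0Sn n) N_gt0 delta_lt (d + ex0).
exists D0 => D /limD[H0 limH].
have [k0 t_k0] := veq_qpoch_inf n.+1 (ltn0Sn n) d.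
exists (n.+1 * H0 + k0)%N => r le_r.
have := limH (residue r) (residue_quo r) r (@residue_lt n r).
have hE (i j : 'I_n.+1) : (i < j)%N ->
    (residue r j + n.+1 * residue_quo r j = residue r i + n.+1 * residue_quo r i + (j - i))%N.
  by rewrite !residueE; lia.
have h_ge (i : 'I_n.+1) : (H0 <= residue_quo r i)%N.
  by rewrite /residue_quo leq_divRL // mulnC; lia.
move=> /(_ hE (sum_residue_quo n r) h_ge); set S := \sum_(rho | _) _ => eqS.
set e := (m * 'C(r, 2) + k * r)%N.
have hlQE : hlQ_inf m k r = q ^+ e *
    (qpoch (q ^+ n.+1) (q ^+ n.+1) r * (lattice_const q n * S)).
  rewrite [RHS]mulrCA /hlQ_inf; congr (_ * _); rewrite [RHS]mulrA mulr_sumr.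
  apply: eq_bigr => rho /eqP sum_rho; rewrite mulrC -[LHS]mulrA.
  rewrite (chain_term_residue iota_X_neq0 iota_X_nroot _ _
    (s := fun i => (rho i)%:Z - (residue_quo r i)%:Z)).
  - by rewrite -!mulrA.
  - by move=> i; rewrite addrC subrK.
  - by rewrite sumrB -!(big_morph Posz PoszD (erefl _)) sum_rho sum_residue_quo subrr.
have [t0 vt vtV] := vunit_qpoch n.+1 r (ltn0Sn n).
have q_e : q ^+ e != 0 by rewrite expf_neq0.
(* Not visible termwise, because of that negative power; it follows from the bound [vge_hlQ_inf] on
   the whole sum. *)
have vS : vge 0 (lattice_const q n * S).
  have [x hlQx] := vge_hlQ_inf r le_km.
  have -> : lattice_const q n * S = iota x * (qpoch (q ^+ n.+1) (q ^+ n.+1) r)^-1.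
    apply: (mulfI q_e); apply: (mulfI t0); rewrite mulrCA -hlQE hlQx -exprnP -/e.
    by field.
  by apply: vgeMl => //; exact: vge_iota.
have eqL : veq d%:Z (lattice_const q n * S)
  (lattice_const q n * box_sum D (residue_lattice_term m k) /
      chain_den_inf n.+1 (fun i j => j - i)%N).
  rewrite /veq -mulrA -mulrBr -[d%:Z](addKr ex0%:Z) -PoszD addnC.
  by apply: vgeM => //; exact: vge_lattice_const.
rewrite hlQE mulKf //; apply: veqM => //.
- exact: vge_iota.
- by apply: t_k0; lia.
Qed.

(** Long chains in [sum_chain_prod]: the gaps to the chain ends become 1, and the two long
    Pochhammer symbols cancel in the limit. *)
Lemma sum_chain_prod_inv (p r d : nat) (c : 'I_n.+1 -> nat) :
  (0 < p)%N -> (forall i, (c i < p)%N) -> injective c ->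
  veq d%:Z
    (\sum_(rho : {ffun 'I_n.+1 -> 'I_r.+1} | (\sum_i rho i == r)%N)
       (chain_prod q p c (fun i => rho i) (fun i => rho i))^-1)
    (qpoch (q ^+ p) (q ^+ p) r)^-1.
Proof.
move=> p_gt0 c_lt c_inj; have [k0 q_k0] := veq_qpoch_inf p p_gt0 d.
pose L := (k0 + r + d + 1)%N.
have le_rL : (r <= L)%N by rewrite /L; lia.
have unitq j : vunit (qpoch (q ^+ p) (q ^+ p) j) := vunit_qpoch p j p_gt0.
have unitI := vunit_qpoch_inf p p_gt0.
apply: (@veq_trans _ (qpoch (q ^+ p) (q ^+ p) (n.+1 * L) /
   (qpoch (q ^+ p) (q ^+ p) r * qpoch (q ^+ p) (q ^+ p) (n.+1 * L - r)))); last first.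
  have [i0 vi viV] := unitI; have [r0 vr vrV] := unitq r.
  have -> : (qpoch (q ^+ p) (q ^+ p) r)^-1 = iota (qpoch_inf (X ^+ p) (X ^+ p)) /
      (qpoch (q ^+ p) (q ^+ p) r * iota (qpoch_inf (X ^+ p) (X ^+ p))).
    by field; rewrite r0 i0.
  have [z0 vz vzV] := unitq (n.+1 * L - r)%N.
  apply: veqM => //; first by rewrite invfM; exact: vgeMl.
    by apply: q_k0; rewrite /L; nia.
  apply: veqV; [exact: vunitM | exact: vunitM |].
  apply: veqM => //; first exact: veq_refl.
  by apply: q_k0; rewrite /L; nia.
apply/veq_sym; rewrite -(sum_chain_prod iota_X_neq0 iota_X_nroot p_gt0 c_lt c_inj le_rL).
apply: veq_sum => rho _; rewrite -[X in veq _ _ X]mul1r.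
have rho_le i : (rho i <= r)%N by rewrite -ltnS.
have far (i j : 'I_n.+1) (l : 'I_(rho i)) : (c i + p * l + d <= c j + p * L)%N.
  have lt_l : (l < r)%N := leq_trans (ltn_ord l) (rho_le i).
  by have := c_lt i; rewrite /L; nia.
apply: veqM; [exact: vge_chain_prod_inv | exact: vge1 | | exact: veq_refl].
rewrite -[X in veq _ _ X](_ : \prod_(i < n.+1) \prod_(l < rho i) \prod_(j < n.+1) 1 = 1);
  last by rewrite !(big1, big1_eq) // => *; rewrite !big1.
apply: veq_prod => i _; [| by do 2 (apply: vge_prod => ? _); exact: vge1 |].
  do 2 (apply: vge_prod => ? _); apply: vge_gap.
  by apply: leq_trans (far _ _ _); exact: leq_addr.
apply: veq_prod => l _; [| by apply: vge_prod => ? _; exact: vge1 |].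
  apply: vge_prod => ? _; apply: vge_gap.
  by apply: leq_trans (far _ _ _); exact: leq_addr.
apply: veq_prod => j _; [| exact: vge1 | exact: veq_gap1].
by apply: vge_gap; apply: leq_trans (far _ _ _); exact: leq_addr.
Qed.

Definition hook_lattice_term (m k : nat) : ('I_n.+1 -> int) -> K :=
  lattice_term q (n.+1 * (m + n.+1))
    (fun w i => (m + n.+1) * w i + n.+1 * hook_exp k i)%N
    (fun w i => hook_exp k i * w i)%N.

(* The coefficientwise limit of [sum_chain_prod], which is Macdonald's identity for
   the affine root system of type A, specialized at powers of [q]. *)
Lemma macdonald_box_limit (m k d : nat) : (k <= m)%N ->
  exists D0, forall D, (D0 <= D)%N ->
  veq d%:Z (iota (qpoch_inf (X ^+ (m + n.+1)) (X ^+ (m + n.+1))))^-1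
    (lattice_const q n * box_sum D (hook_lattice_term m k) /
      chain_den_inf (m + n.+1) (fun i j => hook_exp k j - hook_exp k i)%N).
Proof.
move=> le_km; set ex0 := (\sum_(i < n.+1) (n - i) * i)%N.
have p_gt0 : (0 < m + n.+1)%N by rewrite addnS.
have hook_lt (i : 'I_n.+1) := hook_exp_lt i le_km.
have delta_lt (i j : 'I_n.+1) : (i < j)%N ->
    (0 < hook_exp k j - hook_exp k i < m + n.+1)%N.
  by move=> /(hook_exp_mono k); have := hook_lt j; lia.
have N_gt0 : (0 < n.+1 * (m + n.+1))%N by rewrite muln_gt0.
have [D0 limD] := chain_sum_limit (fun w i => (m + n.+1) * w i + n.+1 * hook_exp k i)%N
  (fun w i => hook_exp k i * w i)%N p_gt0 N_gt0 delta_lt (d + ex0).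
exists D0 => D /limD[H0 limH].
have [k0 t_k0] := veq_qpoch_inf (m + n.+1) p_gt0 d.
(* The claim does not involve [r], so a single large [r] is enough; a multiple of [n.+1] allows
   equal reference lengths. *)
pose H := (H0 + k0)%N; pose r := (n.+1 * H)%N.
have := limH (@hook_exp n k) (fun=> H) r hook_lt.
have hE (i j : 'I_n.+1) : (i < j)%N ->
    (hook_exp k j + (m + n.+1) * H = hook_exp k i + (m + n.+1) * H
      + (hook_exp k j - hook_exp k i))%N.
  by move=> /(hook_exp_mono k); lia.
have sum_h : (\sum_(i < n.+1) H = r)%N by rewrite sum_nat_const card_ord.
move=> /(_ hE sum_h (fun=> leq_addr _ _)); set S := \sum_(rho | _) _ => eqS.
have SE : \sum_(rho : {ffun 'I_n.+1 -> 'I_r.+1} | (\sum_i rho i == r)%N)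
    (chain_prod q (m + n.+1) (@hook_exp n k) (fun i => rho i) (fun i => rho i))^-1 =
    lattice_const q n * S.
  rewrite mulr_sumr; apply: eq_bigr => rho /eqP sum_rho.
  rewrite (chain_term_hook iota_X_neq0 iota_X_nroot le_km
    (s := fun i => (rho i)%:Z - H%:Z) (H := H)).
  - by rewrite -!mulrA.
  - by move=> i; rewrite addrC subrK.
  - by rewrite sumrB -!(big_morph Posz PoszD (erefl _)) sum_rho sum_h subrr.
apply: (@veq_trans _ (qpoch (q ^+ (m + n.+1)) (q ^+ (m + n.+1)) r)^-1).
  apply: veqV; [exact: vunit_qpoch_inf | exact: vunit_qpoch |].
  by apply/veq_sym/t_k0; rewrite /r /H; nia.
apply: (@veq_trans _ (lattice_const q n * S)).
  by rewrite -SE; apply/veq_sym/sum_chain_prod_inv => //; exact: hook_exp_inj.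
rewrite /veq -mulrA -mulrBr -[d%:Z](addKr ex0%:Z) -PoszD addnC.
by apply: vgeM => //; exact: vge_lattice_const.
Qed.

(** In a common box the two sums agree by [box_sum_sym]. Eliminating them with [macdonald_box_limit]
    leaves the quotient of the limiting denominators. *)
Lemma hlQ_inf_limit_K (m k d : nat) : (k <= m)%N -> exists r0, forall r, (r0 <= r)%N ->
  veq d%:Z (q ^- (m * 'C(r, 2) + k * r) * hlQ_inf m k r)
    (iota (qpoch_inf (X ^+ n.+1) (X ^+ n.+1)) *
     ((iota (qpoch_inf (X ^+ (m + n.+1)) (X ^+ (m + n.+1))))^-1 *
      (chain_den_inf (m + n.+1) (fun i j => hook_exp k j - hook_exp k i)%N /
       chain_den_inf n.+1 (fun i j => j - i)%N))).
Proof.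
move=> le_km; have [D1 limA] := hlQ_inf_box_limit d le_km.
have [D2 limB] := macdonald_box_limit d le_km.
have [r0 limr] := limA (D1 + D2)%N (leq_addr _ _).
have {}limB := limB (D1 + D2)%N (leq_addl _ _).
exists r0 => r /limr; set Z := chain_den_inf _ _; set ZB := chain_den_inf (m + _) _ in limB *.
have unitZ : vunit Z.
  by apply: vunit_chain_den_inf => // i j; have := ltn_ord j; lia.
have unitZB : vunit ZB.
  apply: vunit_chain_den_inf; first by rewrite addnS.
  by move=> i j /(hook_exp_mono k); have := hook_exp_lt j le_km; lia.
have [z0 vz vzV] := unitZ; have [zb0 vzb vzbV] := unitZB.
move/veq_trans; apply.
rewrite /veq -mulrBr; apply: vgeMl; first exact: vge_iota.
rewrite /residue_lattice_term box_sum_sym -/(hook_lattice_term m k).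
have ratioE (G P x y : K) : x != 0 -> y != 0 ->
    G / x - P * (y / x) = - (P - G / y) * (y / x).
  by move=> x0 y0; field; rewrite x0 y0.
rewrite ratioE //.
by apply: vgeMr; [exact: vgeN | exact: vgeMl].
Qed.

(** * The infinite products *)

Lemma veq_iota_eq (x y : fps R) : (forall d : nat, veq d%:Z (iota x) (iota y)) -> x = y.
Proof.
move=> eq_xy; have cvg_xy : fps_cvg (fun=> x) y by apply: fps_cvg_vge => d; exists 0%N.
by apply: fpsP => d; have [N0 /(_ N0 (leqnn _))] := cvg_xy d.
Qed.

Lemma qpoch_dissection (N : nat) :
  qpoch q q (N * n.+1) = \prod_(f < n.+1) qpoch (q ^+ f.+1) (q ^+ n.+1) N.
Proof.
elim: N => [|N IHN]; first by rewrite /qpoch big_ord0 big1 // => f _; rewrite big_ord0.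
under eq_bigr => f _ do rewrite qpochS.
rewrite big_split /= -IHN mulSnr /qpoch big_split_ord /=; congr (_ * _).
apply: eq_bigr => f _; congr (1 - _).
by rewrite -exprM -exprD -exprS addSn mulnC addnC.
Qed.

Lemma qpoch_inf_dissection :
  qpoch_inf X X = \prod_(f < n.+1) qpoch_inf (X ^+ f.+1) (X ^+ n.+1).
Proof.
apply: veq_iota_eq => d; rewrite rmorph_prod.
have [k1 q_k1] := veq_qpoch_inf 1 (ltn0Sn 0) d.
have [k2 q_k2] := ex_uniform_bound (fun f : 'I_n.+1 =>
  veq_qpoch_inf f.+1 (ltn0Sn n) d).
apply: (@veq_trans _ (qpoch q q ((k1 + k2) * n.+1))).
  by apply/veq_sym; rewrite -[q]expr1 -[X]expr1; apply: q_k1; nia.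
rewrite qpoch_dissection; apply: veq_prod => f _.
- by have [] := vunit_qpoch n.+1 (k1 + k2) (ltn0Sn f).
- exact: vge_iota.
- by apply: q_k2; exact: leq_addl.
Qed.

(** In row [i] the differences [j - i] modulo [n.+1] run through all classes, the diagonal supplying
    [n.+1]; by [qpoch_inf_dissection] each of the [n.+1] rows equals [qpoch_inf X X]. *)
Lemma chain_den_inf_residue :
  chain_den_inf n.+1 (fun i j => j - i)%N = iota (qpoch_inf X X ^+ n.+1).
Proof.
pose A f := iota (qpoch_inf (X ^+ f) (X ^+ n.+1)).
pose B f := if f == 0%N then A n.+1 else A f.
pose sh (i j : 'I_n.+1) : 'I_n.+1 := Ordinal (ltn_pmod (n.+1 + j - i) (ltn0Sn n)).
have sh_lt (i j : 'I_n.+1) : (i < j)%N -> sh i j = (j - i)%N :> nat.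
  move=> lt_ij; rewrite /= -addnBA ?modnDl ?modn_small //; last exact: ltnW.
  by have := ltn_ord j; lia.
have sh_gt (i j : 'I_n.+1) : (i < j)%N -> sh j i = (n.+1 - (j - i))%N :> nat.
  by move=> lt_ij; rewrite /= modn_small; have := ltn_ord j; lia.
have sh_inj i : injective (sh i).
  move=> j j' /(congr1 val) /= /eqP; rewrite -(eqn_modDr i).
  rewrite !subnK ?eqn_modDl; try by have := ltn_ord i; lia.
  by rewrite (modn_small (ltn_ord j)) (modn_small (ltn_ord j')) => /eqP; exact: val_inj.
transitivity (\prod_(i < n.+1) \prod_(j < n.+1) B (sh i j)).
  rewrite big_pair_split /=; congr (_ * _).
    by apply: eq_bigr => i _; rewrite /B addnK modnn.
  apply: eq_bigr => i _; apply: eq_bigr => j lt_ij; rewrite -/(nat_of_ord (sh i j)).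
  have := sh_lt i j lt_ij; have := sh_gt i j lt_ij; rewrite /= => -> ->.
  by rewrite /B !ifF //; apply/negbTE; have := ltn_ord j; lia.
have prodB : \prod_(f < n.+1) B f = iota (qpoch_inf X X).
  rewrite qpoch_inf_dissection rmorph_prod big_ord_recl [RHS]big_ord_recr mulrC.
  by congr (_ * _).
rewrite rmorphXn /= -prodB -[X in _ ^+ X]card_ord -prodr_const.
apply: eq_bigr => i _; rewrite [RHS](reindex_inj (sh_inj i)).
by [].
Qed.

(** Pairs with [j] the last index meet the raised exponent and give theta at [n + k - i], which
    reversal turns into [i + k]; the other pairs differ by [j - i]. *)
Lemma chain_den_inf_hook (k kappa : nat) :
  chain_den_inf kappa (fun i j => hook_exp k j - hook_exp k i)%N =
  iota (qpoch_inf (X ^+ kappa) (X ^+ kappa) ^+ n.+1 *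
    (\prod_(1 <= i < n.+1) qtheta R (i + k) kappa) *
    \prod_(1 <= i < n.+1) \prod_(i.+1 <= j < n.+1) qtheta R (j - i) kappa).
Proof.
rewrite -mulrA rmorphM rmorphXn /= /chain_den_inf prodr_const card_ord; congr (_ * _).
rewrite rmorphM !rmorph_prod !big_add1 /= !big_mkord.
rewrite big_ord_recr /= [X in _ * X]big1 ?mulr1; last first.
  by move=> j; rewrite ltnNge -ltnS ltn_ord.
transitivity (\prod_(i < n) (iota (qtheta R (n + k - i) kappa) *
    \prod_(j < n | (i < j)%N) iota (qtheta R (j - i) kappa))).
  apply: eq_bigr => i _; rewrite big_mkcond big_ord_recr /= ltn_ord -big_mkcond mulrC.
  have hi : hook_exp k (widen_ord (leqnSn n) i) = i.
    by rewrite /hook_exp ifF // -val_eqE /= ltn_eqF.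
  rewrite hi {1 2}/hook_exp eqxx; congr (_ * _); first by rewrite -rmorphM.
  apply: eq_bigr => j _; rewrite -rmorphM.
  by rewrite {1 2}/hook_exp ifF // -val_eqE /= ltn_eqF.
rewrite big_split /=; congr (_ * _).
  rewrite [LHS](reindex_inj rev_ord_inj) /=; apply: eq_bigr => i _.
  by congr (iota (qtheta R _ _)); have := ltn_ord i; lia.
apply: eq_bigr => i _; rewrite rmorph_prod big_add1 /=.
rewrite [RHS](big_nat_widenl _ 0) // big_mkord.
by apply: eq_big => j; rewrite ?subSS.
Qed.

Lemma fps_unitE (x : fps R) : (x \is a GRing.unit) = (fps_coef x 0 != 0).
Proof. by []. Qed.

Lemma unit_qpoch_inf (a p : nat) : (0 < a)%N ->
  qpoch_inf (X ^+ a) (X ^+ p) \is a GRing.unit.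
Proof.
move=> a_gt0; rewrite fps_unitE /= qpochS /qpoch big_ord0 mul1r mulr1.
by rewrite fps_coefB -[X ^+ a]mulr1 fps_coefXnM a_gt0 subr0 oner_eq0.
Qed.

Lemma hlQ_inf_limit_fps (m k d : nat) : (k <= m)%N -> exists r0, forall r, (r0 <= r)%N ->
  veq d%:Z (q ^- (m * 'C(r, 2) + k * r) * hlQ_inf m k r)
    (iota (qpoch_inf (X ^+ n.+1) (X ^+ n.+1)
           * qpoch_inf (X ^+ (m + n.+1)) (X ^+ (m + n.+1)) ^+ (n.+1 - 1)
           / qpoch_inf X X ^+ n.+1
           * (\prod_(1 <= i < n.+1) qtheta R (i + k) (m + n.+1))
           * \prod_(1 <= i < n.+1) \prod_(i.+1 <= j < n.+1) qtheta R (j - i) (m + n.+1))).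
Proof.
move=> le_km; have [r0 lim] := hlQ_inf_limit_K d le_km; exists r0 => r /lim.
rewrite chain_den_inf_residue chain_den_inf_hook; set kappa := (m + n.+1)%N.
set T1 := \prod_(1 <= i < _) qtheta _ _ _; set T2 := \prod_(1 <= i < _) _.
have kappa_gt0 : (0 < kappa)%N by rewrite /kappa addnS.
have [P0 _ _] := vunit_qpoch_inf kappa kappa_gt0.
have q_unit : qpoch_inf X X ^+ n.+1 \is a GRing.unit.
  by apply: unitrX; have := unit_qpoch_inf 1 (ltn0Sn 0); rewrite expr1; apply.
have iotaE (x y z u v : fps R) : z \is a GRing.unit -> iota y != 0 ->
    iota x * ((iota y)^-1 * (iota (y ^+ n.+1 * u * v) / iota z)) =
    iota (x * y ^+ (n.+1 - 1) / z * u * v).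
  move=> z_unit y0; rewrite subn1 !rmorphM (rmorphV iota) // !rmorphXn /= exprS -!mulrA.
  rewrite mulKf //; congr (_ * (_ * _)).
  by rewrite mulrA mulrC.
by rewrite iotaE.
Qed.

(** [vge_hlQ_inf] provides [L r] as a power series, and [Q r] is defined by multiplying back the
    power of [q]; [hlQ_inf_limit] then identifies it as the limit in [N]. *)
Lemma hlQ_rect_limit (m k : nat) : (0 < m)%N -> (k <= m)%N ->
  exists Q L : nat -> fps R,
    [/\ forall r, exists u : nat -> fps R,
          (forall N, iota (u N) =
             hlQ (fun i : 'I_N => q ^+ i) (q ^+ n.+1) (rect_part m r k)) /\
          fps_cvg u (Q r),
        forall r, iota (L r) = q ^- (m * 'C(r, 2) + k * r) * iota (Q r)
      & fps_cvg L
          (qpoch_inf (X ^+ n.+1) (X ^+ n.+1)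
           * qpoch_inf (X ^+ (m + n.+1)) (X ^+ (m + n.+1)) ^+ (n.+1 - 1)
           / qpoch_inf X X ^+ n.+1
           * (\prod_(1 <= i < n.+1) qtheta R (i + k) (m + n.+1))
           * \prod_(1 <= i < n.+1) \prod_(i.+1 <= j < n.+1) qtheta R (j - i) (m + n.+1))].
Proof.
move=> m_gt0 le_km.
have /choice[L LE] r : exists x : fps R,
    hlQ_inf m k r = q ^+ (m * 'C(r, 2) + k * r) * iota x by exact: vge_hlQ_inf.
have q_e r : q ^+ (m * 'C(r, 2) + k * r) != 0 by rewrite expf_neq0.
have QE r : iota (X ^+ (m * 'C(r, 2) + k * r) * L r) = hlQ_inf m k r.
  by rewrite rmorphM /= iotaXn LE.
exists (fun r => X ^+ (m * 'C(r, 2) + k * r) * L r), L; split => [r|r|].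
- have /choice[u uE] N : exists x : fps R,
      iota x = hlQ (fun i : 'I_N => q ^+ i) (q ^+ n.+1) (rect_part m r k).
    have [x ->] := vge_hlQ N (ltn0Sn n) (rect_part_gt0 r k m_gt0).
    by exists x; rewrite expr0z mul1r.
  exists u; split=> //; apply: fps_cvg_vge => d.
  have [N0 limN] := hlQ_inf_limit k r d m_gt0.
  by exists N0 => N /limN; rewrite uE QE.
- by rewrite QE LE mulKf.
apply: fps_cvg_vge => d; have [r0 limr] := hlQ_inf_limit_fps d le_km.
by exists r0 => r /limr; rewrite LE mulKf.
Qed.

End Valuation.

Theorem theorem4p1 (m n k : nat) (hm : (0 < m)%N) (hn : (0 < n)%N)
    (hk : (k <= m)%N) :
  let q : fps rat := fps_X rat in
  let kappa := (m + n)%N in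
  exists Q L : nat -> fps rat,
    [/\ forall r, (1 <= r)%N -> is_hlQ_principal (rect_part m r k) n (Q r),
        forall r, (1 <= r)%N ->
          (L r)%:F = q%:F ^- (m * 'C(r, 2) + k * r) * (Q r)%:F
      & fps_cvg L
          (qpoch_inf (q ^+ n) (q ^+ n)
           * qpoch_inf (q ^+ kappa) (q ^+ kappa) ^+ (n - 1)
           / qpoch_inf q q ^+ n
           * (\prod_(1 <= i < n) qtheta rat (i + k) kappa)
           * \prod_(1 <= i < n) \prod_(i.+1 <= j < n) qtheta rat (j - i) kappa)].
Proof.
case: n hn => // n _.
have tofrac_inj : injective (@FracField.tofrac (fps rat)).
  by move=> x y /eqP; rewrite tofrac_eq => /eqP.
have [Q [L [QE LE limL]]] := hlQ_rect_limit tofrac_inj (erefl (fps_X rat)%:F) n hm hk.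
by exists Q, L; split => [r _|r _|]; [exact: QE | exact: LE | exact: limL].
Qed.
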